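(* Let $d\ge1$, let $\emptyset\neq H\subset\mathbb{R}^d$, let $A\subset\mathbb{R}^d$ be Lebesgue measurable, and let $R,\Delta$ be real numbers with $d(H,A)\ge R\ge\Delta\ge0$ and $R>0$. Then $T_\Delta A$ is Lebesgue measurable and $$Leb(T_\Delta A)\ge\left(\frac{R-\Delta}{R}\right)^{d-1}Leb(A).$$
   Context: $d(\cdot,\cdot)$ is Euclidean distance, $d(x,H)=\inf_{y\in H}|x-y|$, $d(H,A)=\inf_{x\in A}d(x,H)$, and $Leb$ is Lebesgue measure on $\mathbb{R}^d$. Let $\bar H$ be the closure of $H$. For each $x\in\mathbb{R}^d$ let $\pi(x)$ be a point of $\bar H$ with $|x-\pi(x)|=d(x,H)$ (if there are several such points, $\pi(x)$ is any one of them). For $\Delta\ge0$ the approach map $T_\Delta:\mathbb{R}^d\to\mathbb{R}^d$ is $$T_\Delta x:=\begin{cases} x+\Delta\frac{\pi(x)-x}{|\pi(x)-x|}, & \text{if } d(x,H)>\Delta,\\ \pi(x), & \text{if } d(x,H)\le\Delta.\end{cases}$$ *)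

(* Defs.v *)
From HB Require Import structures.
From mathcomp Require Import all_boot all_order all_algebra.
From mathcomp Require Import all_classical all_reals all_analysis.
Set Implicit Arguments. Unset Strict Implicit. Unset Printing Implicit Defensive.
Import Order.TTheory GRing.Theory Num.Theory.
Import numFieldNormedType.Exports.
Local Open Scope classical_set_scope.
Local Open Scope ring_scope.

Section Defs.
Variables (R : realType) (d : nat).

Definition enorm (x : 'rV[R]_d) : R := Num.sqrt (\sum_(i < d) x ord0 i ^+ 2).

Definition dist_pt (x : 'rV[R]_d) (H : set 'rV[R]_d) : R :=
  inf [set enorm (x - y) | y in H].

(* d(H,A) = inf_{x in A} d(x,H), as an extended real (inf of empty set = +oo) *)
Definition dist_set (H A : set 'rV[R]_d) : \bar R :=
  ereal_inf [set (dist_pt x H)%:E | x in A].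

Definition box (a b : 'rV[R]_d) : set 'rV[R]_d :=
  [set x | forall i : 'I_d, a ord0 i <= x ord0 i <= b ord0 i].
Definition box_vol (a b : 'rV[R]_d) : R := \prod_(i < d) (b ord0 i - a ord0 i).

Definition leb_outer (E : set 'rV[R]_d) : \bar R :=
  ereal_inf [set s : \bar R | exists (a b : nat -> 'rV[R]_d),
    [/\ (forall k (i : 'I_d), a k ord0 i <= b k ord0 i),
        E `<=` \bigcup_k box (a k) (b k) &
        s = (\sum_(0 <= k <oo) (box_vol (a k) (b k))%:E)%E]].

Definition leb_measurable (E : set 'rV[R]_d) : Prop :=
  forall S : set 'rV[R]_d, leb_outer S = (leb_outer (S `&` E) + leb_outer (S `&` ~` E))%E.
Definition Leb (E : set 'rV[R]_d) : \bar R := leb_outer E.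

Definition nearest_point_map (H : set 'rV[R]_d) (pi : 'rV[R]_d -> 'rV[R]_d) : Prop :=
  forall x, closure H (pi x) /\ enorm (x - pi x) = dist_pt x H.

Definition approach (H : set 'rV[R]_d) (pi : 'rV[R]_d -> 'rV[R]_d) (Delta : R)
  (x : 'rV[R]_d) : 'rV[R]_d :=
  if Delta < dist_pt x H then x + (Delta / enorm (pi x - x)) *: (pi x - x)
  else pi x.
End Defs.

(* Main.v *)
Require Import Defs.
From HB Require Import structures.
From mathcomp Require Import all_boot all_order fingroup perm all_algebra.
From mathcomp Require Import all_classical all_reals all_analysis.
From mathcomp Require Import ring lra.
Import Order.TTheory GRing.Theory Num.Theory.
Import numFieldNormedType.Exports.
Local Open Scope classical_set_scope.
Local Open Scope ring_scope.

(* For a single center h the inverse of the approach map is the radial push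
   y |-> y + D (y - h) / |y - h|, whose derivative is the identity along the ray
   and (1 + D / r) orthogonally to it, so it multiplies measures by at most
   (1 + D / r) ^ (d - 1).  If H is finite, each Voronoi cell is star-shaped about
   its center, hence mapped into itself, and the bounds for the cells add up.
   In general let H_m be the first m points of a dense sequence in H.  If U is
   open and contains all images of A, for all choices of nearest points, then by
   compactness every x in A is eventually sent into U by the approach map of H_m;
   this bounds the outer measure of an arbitrary set A by that of its
   multivalued image.

   Multivaluedness and measurability are controlled by the points at which
   shortest segments to H end.  Pulling these by different lengths gives disjoint
   sets, each of measure bounded below by the inequality just obtained, so they
   are null, as are their images.  Away from them the nearest point is unique
   and, where shortest segments prolong by a fixed length, a Lipschitz function
   of x, so that the approach map preserves measurability. *)

(** * Lebesgue outer measure *)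

(** Everything is stated for outer measures, because the order of dependence forces it:
    measurability of the image rests on the nullity of the ends of shortest segments, and this
    nullity comes from the inequality applied to the multivalued images [pulls], not yet known to be
    measurable. The sets of points settled from some stage on are in the same position, hence
    continuity from below for arbitrary sets. Using the inverse [push] turns a lower bound into an
    upper bound, which covers by small cubes can give: on a cube of side $\delta$ the map is affine
    up to $O(\delta^2)$, and a linear map scales outer measure by at most its absolute determinant.
    Pulled points keep distance at least $R-\Delta$ from the center, so the factor is
    $(1+\Delta/(R-\Delta))^{d-1}=(R/(R-\Delta))^{d-1}$. This degenerates at $\Delta=R$. For $d>1$
    the claim is then trivial, but for $d=1$ the constant is $0^0=1$, and $A$ has to be exhausted by
    its points at distance at least $R+1/(n+1)$; the level set at distance $R$ and its image are
    null. In the lemmas on measure the dimension is written [d.+1], so the exponent is [d]. *)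

Section OuterMeasure.
Context {R : realType} {d : nat}.
Local Notation V := 'rV[R]_d.+1.
Implicit Types (E F : set V).

Lemma box_vol_ge0 (a b : V) : (forall i, a ord0 i <= b ord0 i) -> 0 <= box_vol a b.
Proof. by move=> ab; apply: prodr_ge0 => i _; rewrite subr_ge0. Qed.

Definition box_cover E (a b : nat -> V) :=
  (forall k i, a k ord0 i <= b k ord0 i) /\ E `<=` \bigcup_k box (a k) (b k).

Lemma leb_outer_le_cover E (a b : nat -> V) : box_cover E a b ->
  (leb_outer E <= \sum_(0 <= k <oo) (box_vol (a k) (b k))%:E)%E.
Proof. by case=> ab Eab; apply: ereal_inf_lbound; exists a, b; split. Qed.

Lemma leb_outer_approx E (e : R) : (leb_outer E < +oo)%E -> 0 < e ->
  exists a b, box_cover E a b /\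
    (\sum_(0 <= k <oo) (box_vol (a k) (b k))%:E <= leb_outer E + e%:E)%E.
Proof.
move=> Efin e0; have lee : (leb_outer E < leb_outer E + e%:E)%E.
  have : (0 <= leb_outer E)%E.
    apply: le_ereal_inf_tmp => _ [a [b [ab _ ->]]].
    by apply: nneseries_ge0 => n _ _; rewrite lee_fin box_vol_ge0.
  by case: (leb_outer E) Efin => // r _ _; rewrite -EFinD lte_fin ltrDl.
have [_ [a [b [ab Eab ->]]] lts] := ereal_inf_lt lee.
by exists a, b; split => //; exact/ltW.
Qed.

Lemma leb_outer_ge0 E : (0 <= leb_outer E)%E.
Proof.
apply: le_ereal_inf_tmp => _ [a [b [ab _ ->]]].
by apply: nneseries_ge0 => n _ _; rewrite lee_fin box_vol_ge0.
Qed.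

Lemma box_vol_refl (a : V) : box_vol a a = 0.
Proof. by rewrite /box_vol (bigD1 ord0)//= subrr mul0r. Qed.

Lemma leb_outer_box (a b : V) : (forall i, a ord0 i <= b ord0 i) ->
  (leb_outer (box a b) <= (box_vol a b)%:E)%E.
Proof.
move=> ab; apply: le_trans (leb_outer_le_cover _
  (fun k => if k is 0%N then a else 0) (fun k => if k is 0%N then b else 0) _) _.
  split; last by move=> x xab; exists 0%N.
  by case=> [|k] i //=.
rewrite nneseries_recl//; last first.
  by move=> n *; rewrite lee_fin; apply: box_vol_ge0; case: n => *.
rewrite eseries_cond/= eseries0 ?adde0// => -[|k]//= _ _.
by rewrite box_vol_refl.
Qed.

Lemma leb_outer0 : leb_outer (@set0 V) = 0%E.
Proof.
apply/eqP; rewrite eq_le leb_outer_ge0 andbT.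
apply: le_trans (leb_outer_le_cover _ (fun=> 0) (fun=> 0) _) _; first by split.
by rewrite eseries0// => k _ _; rewrite box_vol_refl.
Qed.

Lemma le_leb_outer : {homo @leb_outer R d.+1 : E F / E `<=` F >-> (E <= F)%E}.
Proof.
move=> E F EF; apply: ereal_inf_le_tmp => _ [a [b [ab Fab ->]]].
by exists a, b; split => //; exact: subset_trans Fab.
Qed.

Lemma leb_outer_sigma_subadditive : sigma_subadditive (@leb_outer R d.+1).
Proof.
move=> A; have [[i Aioo]|Afin] := pselect (exists i, leb_outer (A i) = +oo%E).
  rewrite (eseries_pinfty _ _ Aioo) ?leey// => n _.
  by rewrite -ltNye (lt_le_trans _ (leb_outer_ge0 _)).
apply/lee_addgt0Pr => e e0.
rewrite (le_trans _ (epsilon_trick _ _ (ltW e0)))//; last first.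
  by move=> n; exact: leb_outer_ge0.
pose P n (B : (nat -> V) * (nat -> V)) := box_cover (A n) B.1 B.2 /\
  (\sum_(0 <= k <oo) (box_vol (B.1 k) (B.2 k))%:E <=
   leb_outer (A n) + (e / (2 ^ n.+1)%:R)%:E)%E.
have [G PG] : {G & forall n, P n (G n)}.
  apply: (@choice _ _ P) => n.
  have [||a [b [? ?]]] := @leb_outer_approx (A n) (e / (2 ^ n.+1)%:R).
  - by rewrite ltey; apply/eqP => Anoo; apply: Afin; exists n.
  - by rewrite divr_gt0// ltr0n expn_gt0.
  - by exists (a, b).
pose v (p : nat * nat) : \bar R :=
  (box_vol ((G p.1).1 p.2) ((G p.1).2 p.2))%:E.
have v0 p : (0 <= v p)%E by rewrite lee_fin box_vol_ge0//; apply: (PG _).1.1.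
apply: (@le_trans _ _ (\esum_(p in setT) v p)%E).
  (* A bijection of [nat] with [nat * nat] lists the boxes of all the covers as one cover; the two
     sums are compared through [\esum]. *)
  have /card_esym/ppcard_eqP[f] := card_nat2.
  apply: le_trans (leb_outer_le_cover _
    (fun k => (G (f k).1).1 (f k).2) (fun k => (G (f k).1).2 (f k).2) _) _.
    split=> [k i|x [i _ Aix]]; first exact: (PG _).1.1.
    have [j _ xij] := (PG i).1.2 _ Aix.
    by exists (f^-1%FUN (i, j)) => //=; rewrite invK ?inE.
  rewrite -(esum_pred_image v f xpredT) ?[fun=> _]set_true//.
  by rewrite image_eq.
rewrite (_ : esum _ _ = \sum_(i <oo) \sum_(j <oo) v (i, j))%E; last first.
  rewrite nneseries_esumT; last by move=> n; exact: nneseries_ge0.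
  under [RHS]eq_esum do rewrite nneseries_esumT//.
  rewrite esum_esum//; congr esum.
  by apply/seteqP; split=> // -[i j].
by apply: lee_nneseries => [n _ _|n _]; [exact: nneseries_ge0|exact: (PG n).2].
Qed.

(** Since [leb_measurable] is Caratheodory's criterion for this outer measure, the instance makes
    the general Caratheodory theory applicable to it. *)
HB.instance Definition _ := isOuterMeasure.Build R V (@leb_outer R d.+1)
  leb_outer0 leb_outer_ge0 le_leb_outer leb_outer_sigma_subadditive.

End OuterMeasure.

(** * Euclidean norm and distance to a set *)

Section Euclidean.
Context {R : realType} {n : nat}.
Local Notation V := 'rV[R]_n.
Implicit Types (x y z : V).

Definition dot x y : R := \sum_(i < n) x ord0 i * y ord0 i.

Lemma dotC x y : dot x y = dot y x.
Proof. by apply: eq_bigr => i _; rewrite mulrC. Qed.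

Lemma dotDl x y z : dot (x + y) z = dot x z + dot y z.
Proof. by rewrite -big_split; apply: eq_bigr => i _; rewrite mxE mulrDl. Qed.

Lemma dotDr x y z : dot z (x + y) = dot z x + dot z y.
Proof. by rewrite dotC dotDl !(dotC _ z). Qed.

Lemma dotZl c x y : dot (c *: x) y = c * dot x y.
Proof. by rewrite mulr_sumr; apply: eq_bigr => i _; rewrite mxE mulrA. Qed.

Lemma dotZr c x y : dot x (c *: y) = c * dot x y.
Proof. by rewrite dotC dotZl dotC. Qed.

Lemma dotNl x y : dot (- x) y = - dot x y.
Proof. by rewrite -scaleN1r dotZl mulN1r. Qed.

Lemma dotNr x y : dot x (- y) = - dot x y.
Proof. by rewrite dotC dotNl dotC. Qed.

Definition dotE := (dotDl, dotDr, dotZl, dotZr, dotNl, dotNr).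

Lemma dot_ge0 x : 0 <= dot x x.
Proof. by apply: sumr_ge0 => i _; rewrite -expr2 sqr_ge0. Qed.

Lemma enorm_ge0 x : 0 <= enorm x.
Proof. exact: sqrtr_ge0. Qed.

Lemma sqr_enorm x : enorm x ^+ 2 = dot x x.
Proof.
rewrite sqr_sqrtr; last by apply: sumr_ge0 => i _; rewrite sqr_ge0.
by apply: eq_bigr => i _; rewrite expr2.
Qed.

Lemma enorm_le x (c : R) : 0 <= c -> (enorm x <= c) = (dot x x <= c ^+ 2).
Proof. by move=> c0; rewrite -sqr_enorm ler_sqr// ?nnegrE ?enorm_ge0. Qed.

Lemma enorm_ge x (c : R) : 0 <= c -> (c <= enorm x) = (c ^+ 2 <= dot x x).
Proof. by move=> c0; rewrite -sqr_enorm ler_sqr// ?nnegrE ?enorm_ge0. Qed.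

Lemma coord_le_enorm x i : `|x ord0 i| <= enorm x.
Proof.
rewrite enorm_ge// real_normK ?num_real// /dot (bigD1 i)//= -expr2 lerDl.
by apply: sumr_ge0 => j _; rewrite -expr2 sqr_ge0.
Qed.

Lemma enorm_le_coord x (M : R) : (forall i, `|x ord0 i| <= M) -> 0 <= M ->
  enorm x <= n%:R * M.
Proof.
move=> xM M0; rewrite enorm_le; last by rewrite mulr_ge0.
apply: (@le_trans _ _ (\sum_(i < n) M ^+ 2)).
  apply: ler_sum => i _; rewrite -expr2 -(real_normK (num_real (x ord0 i))).
  by rewrite ler_sqr// nnegrE (le_trans _ (xM i)).
rewrite sumr_const card_ord -[leLHS]mulr_natl exprMn; apply: ler_wpM2r.
  exact: sqr_ge0.
by rewrite -natrX ler_nat; case: n => // m; rewrite expnS expn1 leq_pmulr.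
Qed.

Lemma enorm_eq0 x : enorm x = 0 -> x = 0.
Proof.
move=> x0; apply/rowP => i; rewrite mxE; apply/eqP; rewrite -normr_le0 -x0.
exact: coord_le_enorm.
Qed.

Lemma enorm0 : enorm (0 : V) = 0.
Proof.
by apply/eqP; rewrite -sqrf_eq0 sqr_enorm -(scale0r 0) dotZl mul0r.
Qed.

Lemma enormN x : enorm (- x) = enorm x.
Proof.
by apply/eqP; rewrite -(@eqrXn2 _ 2)// ?enorm_ge0// !sqr_enorm !dotE opprK.
Qed.

Lemma enorm_sym x y : enorm (x - y) = enorm (y - x).
Proof. by rewrite -enormN opprB. Qed.

Lemma enormZ c x : enorm (c *: x) = `|c| * enorm x.
Proof.
apply/eqP; rewrite -(@eqrXn2 _ 2)// ?enorm_ge0 ?mulr_ge0 ?enorm_ge0//.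
by rewrite exprMn !sqr_enorm !dotE real_normK ?num_real// mulrA expr2.
Qed.

Lemma cauchy_schwarz x y : dot x y <= enorm x * enorm y.
Proof.
have [/enorm_eq0 ->|x0] := eqVneq (enorm x) 0.
  by rewrite enorm0 mul0r -(scale0r 0) dotZl mul0r.
have [/enorm_eq0 ->|y0] := eqVneq (enorm y) 0.
  by rewrite enorm0 mulr0 -(scale0r 0) dotZr mul0r.
have xy0 : 0 < enorm x * enorm y.
  by rewrite mulr_gt0// lt0r ?x0 ?y0 enorm_ge0.
have := dot_ge0 (enorm y *: x - enorm x *: y).
rewrite !dotE (dotC y x) -!sqr_enorm => H.
rewrite -subr_ge0 -(pmulr_rge0 _ xy0); lra.
Qed.

Lemma ler_enormD x y : enorm (x + y) <= enorm x + enorm y.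
Proof.
rewrite enorm_le ?addr_ge0 ?enorm_ge0// !dotE (dotC y x) -!sqr_enorm.
by have := cauchy_schwarz x y; lra.
Qed.

Lemma ler_edist_add z x y : enorm (x - y) <= enorm (x - z) + enorm (z - y).
Proof. by rewrite -(subrKA z); exact: ler_enormD. Qed.

(** Equality case of the triangle inequality. Adding the three squared hypotheses with weights
    $b^2+ab$, $a^2+ab$ and $ab$ bounds $|bx-ay|^2$ by 0. *)
Lemma enormD_eq x y (a b : R) : 0 <= a -> 0 <= b -> enorm x <= a ->
  enorm y <= b -> a + b <= enorm (x + y) -> b *: x = a *: y.
Proof.
move=> a0 b0; rewrite !enorm_le// enorm_ge ?addr_ge0// !dotE (dotC y x).
move=> xa yb ab; apply/eqP; rewrite -subr_eq0; apply/eqP/enorm_eq0.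
apply/eqP; rewrite eq_le enorm_ge0 andbT enorm_le// expr0n/= !dotE (dotC y x).
have ab0 : 0 <= a * b by rewrite mulr_ge0.
have H1 := ler_wpM2l (addr_ge0 (sqr_ge0 b) ab0) xa.
have H2 := ler_wpM2l (addr_ge0 (sqr_ge0 a) ab0) yb.
have H3 := ler_wpM2l ab0 ab.
lra.
Qed.

End Euclidean.

(** * Euclidean balls and the ambient topology *)

Section Topology.
Context {R : realType} {n : nat}.
Local Notation V := 'rV[R]_n.
Implicit Types (x y z : V).

(** The topology of row vectors comes from the maximum norm, which [coord_le_enorm] and
    [enorm_le_coord] compare with [enorm]. The divisor [n%:R + 1] is positive even for [n = 0]. *)
Lemma nbhs_enormP x (U : set V) :
  nbhs x U <-> exists2 e : R, 0 < e & forall y, enorm (y - x) < e -> U y.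
Proof.
split=> [/nbhs_ballP[e /= e0 xeU]|[e e0 xeU]].
  exists e => // y yx; apply: xeU; split=> // i j; rewrite ord1.
  rewrite /ball/= (le_lt_trans _ yx)//.
  by have := coord_le_enorm (y - x) j; rewrite !mxE distrC.
apply/nbhs_ballP; have n0 : (0 : R) < n%:R + 1 by rewrite ltr_wpDl.
exists (e / (n%:R + 1)) => /=; first by rewrite divr_gt0.
move=> y [_ xy]; apply: xeU; apply: (@le_lt_trans _ _ (n%:R * (e / (n%:R + 1)))).
  apply: enorm_le_coord; last by rewrite divr_ge0 ?ltW.
  by move=> i; have /ltW := xy ord0 i; rewrite !mxE distrC.
by rewrite mulrCA gtr_pMr// ltr_pdivrMr// mul1r ltrDl.
Qed.

Lemma closure_enormP (H : set V) x :
  closure H x <-> forall e : R, 0 < e -> exists2 y, H y & enorm (x - y) < e.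
Proof.
split=> [Hx e e0|Hx B /nbhs_enormP[e e0 eB]].
  have [|y [Hy yx]] := Hx [set y | enorm (x - y) < e]; last by exists y.
  by apply/nbhs_enormP; exists e => // y; rewrite enorm_sym.
by have [y Hy yx] := Hx _ e0; exists y; split=> //; apply: eB; rewrite enorm_sym.
Qed.

Lemma open_enormP (U : set V) :
  open U <-> forall x, U x -> exists2 e : R, 0 < e & forall y, enorm (y - x) < e -> U y.
Proof.
rewrite openE; split=> H x Ux; first exact/nbhs_enormP/H.
exact/nbhs_enormP/H.
Qed.

End Topology.

(** * Lipschitz functions, continuity and compactness *)

Section Continuity.
Context {R : realType} {n : nat}.
Local Notation V := 'rV[R]_n.
Implicit Types (x y z : V).

Lemma lipschitz_continuous_within m (K : set V) (f : V -> 'rV[R]_m) (C : R) :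
  (forall x y, K x -> K y -> enorm (f x - f y) <= C * enorm (x - y)) ->
  {within K, continuous f}.
Proof.
move=> fC; apply/subspace_continuousP => x Kx B /nbhs_enormP[e e0 eB].
have C0 : 0 < `|C| + 1 by rewrite ltr_wpDl.
apply/nbhs_enormP; exists (e / (`|C| + 1)) => [|y]; first by rewrite divr_gt0.
rewrite ltr_pdivlMr// mulrC => yx Ky; apply: eB.
apply: le_lt_trans yx; apply: le_trans (fC _ _ Ky Kx) _; apply: ler_wpM2r.
  exact: enorm_ge0.
by rewrite (le_trans (ler_norm _))// lerDl.
Qed.

Lemma lipschitz_continuous (f : V -> R) (C : R) :
  (forall x y, `|f x - f y| <= C * enorm (x - y)) -> continuous f.
Proof.
move=> fC x B /nbhs_ballP[e /= e0 eB]; apply/nbhs_enormP.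
have C0 : 0 < `|C| + 1 by rewrite ltr_wpDl.
exists (e / (`|C| + 1)) => [|y]; first by rewrite divr_gt0.
rewrite ltr_pdivlMr// mulrC enorm_sym => yx; apply: eB => /=.
apply: le_lt_trans yx; apply: le_trans (fC _ _) _; apply: ler_wpM2r.
  exact: enorm_ge0.
by rewrite (le_trans (ler_norm _))// lerDl.
Qed.

Lemma continuous_closed_le (f : V -> R) (c : R) : continuous f ->
  closed [set x | f x <= c].
Proof.
move=> /continuous_closedP cf.
exact: (cf [set r : R | r <= c] (@closed_le _ c)).
Qed.

Lemma continuous_closed_ge (f : V -> R) (c : R) : continuous f ->
  closed [set x | c <= f x].
Proof.
move=> /continuous_closedP cf.
exact: (cf [set r : R | c <= r] (@closed_ge _ c)).
Qed.

Lemma continuous_open_lt (f : V -> R) (c : R) : continuous f ->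
  open [set x | f x < c].
Proof. by move=> /continuousP cf; exact: (cf [set r : R | r < c] (@open_lt _ c)). Qed.

Lemma edist_continuous x : continuous (fun y => enorm (x - y)).
Proof.
apply: (@lipschitz_continuous _ 1) => y z; rewrite mul1r ler_norml.
have := ler_edist_add z x y; have := ler_edist_add y x z.
by rewrite (enorm_sym z y); lra.
Qed.

Lemma enorm_continuous : continuous (@enorm R n).
Proof.
have -> : @enorm R n = fun y => enorm (0 - y).
  by apply/funext => x; rewrite sub0r enormN.
exact: edist_continuous.
Qed.

Lemma enorm_compact (K : set V) (M : R) : closed K ->
  (forall x, K x -> enorm x <= M) -> compact K.
Proof.
move=> cK KM; apply: bounded_closed_compact => //.
exists M; split; first exact: num_real.
move=> r Mr x Kx /=; apply: le_trans (ltW Mr); apply: le_trans (KM _ Kx).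
rewrite /Num.norm/=; have [->|] := eqVneq (mx_norm x) 0; first exact: enorm_ge0.
by move=> /mx_norm_neq0[i ->]; rewrite (ord1 i.1) coord_le_enorm.
Qed.

(** The minimum is attained. This turns approximate solutions into exact ones, for nearest points
    and for prolongations of segments. *)
Lemma compact_exists_le0 (K : set V) (f : V -> R) : compact K -> continuous f ->
  (forall e, 0 < e -> exists2 x, K x & f x <= e) -> exists2 x, K x & f x <= 0.
Proof.
move=> cK cf Kf.
have K0 : K !=set0 by have [x Kx _] := Kf _ ltr01; exists x.
have [x /set_mem Kx fx] := compact_EVT_min K0 cK (continuous_subspaceT cf).
exists x => //; apply/ler_addgt0Pr => e e0; rewrite add0r.
by have [y Ky] := Kf _ e0; apply: le_trans; apply: fx; rewrite inE.
Qed.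

End Continuity.

(** * Distance to a set *)

Section Distance.
Context {R : realType} {n : nat}.
Variable H : set 'rV[R]_n.
Hypothesis H0 : H !=set0.
Implicit Types x y z : 'rV[R]_n.

Let dist_has_lbound x : has_lbound [set enorm (x - y) | y in H].
Proof. by exists 0 => _ [y _ <-]; exact: enorm_ge0. Qed.

Let dist_nonempty x : [set enorm (x - y) | y in H] !=set0.
Proof. by case: H0 => y Hy; exists (enorm (x - y)), y. Qed.

Lemma dist_pt_le x y : H y -> dist_pt x H <= enorm (x - y).
Proof. by move=> Hy; apply: ge_inf => //; exists y. Qed.

Lemma dist_pt_ge x (r : R) : (forall y, H y -> r <= enorm (x - y)) ->
  r <= dist_pt x H.
Proof. by move=> rH; apply: lb_le_inf => // _ [y Hy <-]; exact: rH. Qed.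

Lemma dist_pt_approx x (e : R) : 0 < e ->
  exists2 y, H y & enorm (x - y) < dist_pt x H + e.
Proof.
move=> e0.
have [_ [y Hy <-] ye] := inf_adherent e0 (conj (dist_nonempty x) (dist_has_lbound x)).
by exists y.
Qed.

Lemma dist_pt_ge0 x : 0 <= dist_pt x H.
Proof. by apply: dist_pt_ge => y _; exact: enorm_ge0. Qed.

Lemma dist_pt_le_closure x y : closure H y -> dist_pt x H <= enorm (x - y).
Proof.
move=> /closure_enormP Hy; apply/ler_addgt0Pr => e /Hy[z Hz yz].
apply: le_trans (dist_pt_le x z Hz) _; apply: le_trans (ler_edist_add y _ _) _.
by rewrite lerD2l ltW.
Qed.

Lemma dist_pt_lipschitz x y : dist_pt x H <= dist_pt y H + enorm (x - y).
Proof.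
rewrite -lerBlDr; apply: dist_pt_ge => z Hz; rewrite lerBlDr.
apply: le_trans (dist_pt_le x z Hz) _.
by rewrite [leRHS]addrC; exact: ler_edist_add.
Qed.

Lemma dist_pt_continuous : continuous (fun x => dist_pt x H).
Proof.
apply: (@lipschitz_continuous _ _ _ 1) => x y; rewrite mul1r ler_norml.
have := dist_pt_lipschitz x y; have := dist_pt_lipschitz y x.
by rewrite (enorm_sym y x); lra.
Qed.

End Distance.

(** * Measurability and regularity *)

Section Measurability.
Context {R : realType} {d : nat}.
Local Notation V := 'rV[R]_d.+1.
Local Notation mu := (@leb_outer R d.+1).
Implicit Types (E F : set V).

Lemma leb_measurable0 : leb_measurable (@set0 V).
Proof. exact: caratheodory_measurable_set0. Qed.

Lemma le_leb_measurable E :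
  (forall X, (mu (X `&` E) + mu (X `&` ~` E) <= mu X)%E) -> leb_measurable E.
Proof. exact: le_caratheodory_measurable. Qed.

Lemma leb_measurableC E : leb_measurable E -> leb_measurable (~` E).
Proof. exact: caratheodory_measurable_setC. Qed.

Lemma leb_measurableU E F : leb_measurable E -> leb_measurable F ->
  leb_measurable (E `|` F).
Proof. exact: caratheodory_measurable_setU. Qed.

Lemma leb_measurableI E F : leb_measurable E -> leb_measurable F ->
  leb_measurable (E `&` F).
Proof. exact: caratheodory_measurable_setI. Qed.

Lemma leb_measurableD E F : leb_measurable E -> leb_measurable F ->
  leb_measurable (E `\` F).
Proof. exact: caratheodory_measurable_setD. Qed.

Lemma leb_measurable_bigcup (F : nat -> set V) :
  (forall k, leb_measurable (F k)) -> leb_measurable (\bigcup_k F k).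
Proof. exact: caratheodory_measurable_bigcup. Qed.

Lemma leb_measurable_bigcap (F : nat -> set V) :
  (forall k, leb_measurable (F k)) -> leb_measurable (\bigcap_k F k).
Proof.
move=> mF; rewrite -[X in leb_measurable X]setCK setC_bigcap.
by apply/leb_measurableC/leb_measurable_bigcup => k; exact/leb_measurableC.
Qed.

Lemma leb_measurable_fin_bigcap (I : finType) (F : I -> set V) :
  (forall i, leb_measurable (F i)) -> leb_measurable [set x | forall i, F i x].
Proof.
move=> mF; pose G k := if unpickle k is Some i then F i else setT.
rewrite (_ : [set x | _] = \bigcap_k G k).
  apply: leb_measurable_bigcap => k; rewrite /G; case: unpickle => //.
  by rewrite -setC0; exact/leb_measurableC/leb_measurable0.
apply/seteqP; split=> [x Fx k _|x Gx i]; first by rewrite /G; case: unpickle.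
by have := Gx (pickle i) Logic.I; rewrite /G pickleK.
Qed.

Lemma leb_null_measurable E : mu E = 0%E -> leb_measurable E.
Proof.
move=> E0; apply: le_leb_measurable => X.
rewrite [X in (X + _)%E](_ : _ = 0%E) ?add0e; first exact: le_leb_outer.
apply/eqP; rewrite eq_le leb_outer_ge0 andbT -E0; exact: le_leb_outer.
Qed.

Lemma leb_null_sub E F : E `<=` F -> mu F = 0%E -> mu E = 0%E.
Proof.
by move=> EF F0; apply/eqP; rewrite eq_le leb_outer_ge0 andbT -F0 le_leb_outer.
Qed.

Lemma leb_null_bigcup (F : nat -> set V) : (forall k, mu (F k) = 0%E) ->
  mu (\bigcup_k F k) = 0%E.
Proof.
move=> F0; apply/eqP; rewrite eq_le leb_outer_ge0 andbT.
apply: le_trans (leb_outer_sigma_subadditive F) _.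
by rewrite eseries0// => k _ _; rewrite F0.
Qed.

Lemma leb_outerU2 E F : (mu (E `|` F) <= mu E + mu F)%E.
Proof. exact: outer_measureU2. Qed.

Lemma leb_outerU_null E F : mu F = 0%E -> mu (E `|` F) = mu E.
Proof.
move=> F0; apply/eqP; rewrite eq_le; apply/andP; split; last exact: le_leb_outer.
by apply: le_trans (leb_outerU2 E F) _; rewrite F0 adde0.
Qed.

Definition rowset (x : V) (i : 'I_d.+1) (c : R) : V :=
  \row_j (if j == i then c else x ord0 j).

Lemma box_volD1 (a b : V) i : box_vol a b =
  (b ord0 i - a ord0 i) * \prod_(j < d.+1 | j != i) (b ord0 j - a ord0 j).
Proof. by rewrite /box_vol (bigD1 i). Qed.

Lemma box_vol_split (a b : V) i (c : R) :
  box_vol a (rowset b i c) + box_vol (rowset a i c) b = box_vol a b.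
Proof.
rewrite !(box_volD1 _ _ i) !mxE eqxx.
have H1 : \prod_(j < d.+1 | j != i) (rowset b i c ord0 j - a ord0 j) =
    \prod_(j < d.+1 | j != i) (b ord0 j - a ord0 j).
  by apply: eq_bigr => j /negbTE ji; rewrite mxE ji.
have H2 : \prod_(j < d.+1 | j != i) (b ord0 j - rowset a i c ord0 j) =
    \prod_(j < d.+1 | j != i) (b ord0 j - a ord0 j).
  by apply: eq_bigr => j /negbTE ji; rewrite mxE ji.
by rewrite H1 H2; ring.
Qed.

(** Each box of a cover of [X] is cut along the hyperplane, which preserves total volume. The weak
    inequalities leave the hyperplane itself to either side, so that open and closed half-spaces are
    both included. *)
Lemma leb_measurable_halfspace E i (c : R) :
  (forall x, E x -> x ord0 i <= c) -> (forall x, ~ E x -> c <= x ord0 i) ->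
  leb_measurable E.
Proof.
move=> Elt Ege; apply: le_leb_measurable => X.
have [|Xfin] := eqVneq (mu X) +oo%E; first by move=> ->; rewrite leey.
apply/lee_addgt0Pr => e e0.
have [|a [b [[ab Xab] ablt]]] := @leb_outer_approx R d X e _ e0.
  by rewrite ltey.
apply: le_trans ablt.
(* The cut [c] is clamped to the side of the box, so both pieces are boxes with ordered corners, one
   possibly degenerate. *)
pose m k := Num.max (a k ord0 i) (Num.min (b k ord0 i) c).
have am k : a k ord0 i <= m k by rewrite le_max lexx.
have mb k : m k <= b k ord0 i by rewrite ge_max ab ge_min lexx.
have c1 : box_cover (X `&` E) a (fun k => rowset (b k) i (m k)).
  split=> [k j|x [Xx Ex]]; first by rewrite mxE; case: eqP => // ->.
  have [k _ xab] := Xab _ Xx; exists k => // j; have := xab j; rewrite mxE.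
  case: eqP => // -> /andP[-> xb] /=.
  by rewrite le_max le_min xb Elt// orbT.
have c2 : box_cover (X `&` ~` E) (fun k => rowset (a k) i (m k)) b.
  split=> [k j|x [Xx Ex]]; first by rewrite mxE; case: eqP => // ->.
  have [k _ xab] := Xab _ Xx; exists k => // j; have := xab j; rewrite mxE.
  case: eqP => // -> /andP[xa ->] /=.
  by rewrite ge_max xa ge_min Ege// orbT.
apply: le_trans (leeD (leb_outer_le_cover _ _ _ c1) (leb_outer_le_cover _ _ _ c2)) _.
rewrite -nneseriesD; last 2 first.
- by move=> k *; rewrite lee_fin; apply: box_vol_ge0 => j; exact: c1.1.
- by move=> k *; rewrite lee_fin; apply: box_vol_ge0 => j; exact: c2.1.
by under eq_eseriesr do rewrite -EFinD box_vol_split.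
Qed.

Lemma leb_measurable_box (a b : V) : leb_measurable (box a b).
Proof.
pose F i := [set x : V | x ord0 i <= b ord0 i] `\` [set x | x ord0 i < a ord0 i].
rewrite (_ : box a b = [set x | forall i, F i x]).
  apply: leb_measurable_fin_bigcap => i; apply: leb_measurableD.
    apply: (@leb_measurable_halfspace _ i (b ord0 i)) => [x //|x /negP].
    by rewrite -ltNge => /ltW.
  apply: (@leb_measurable_halfspace _ i (a ord0 i)) => [x /ltW //|x /negP].
  by rewrite -leNgt.
apply/seteqP; split=> x /= xab i.
  by have /andP[ax xb] := xab i; split=> //=; apply/negP; rewrite -leNgt.
by have [/= -> /negP] := xab i; rewrite -leNgt => ->.
Qed.

Lemma leb_measurable_open (U : set V) : open U -> leb_measurable U.
Proof.
move=> /open_enormP oU.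
(* An open set is the union of the boxes with rational corners that it contains; [pickle] enumerates
   them. *)
pose bx (p : 'rV[rat]_d.+1 * 'rV[rat]_d.+1) : set V :=
  box (map_mx ratr p.1) (map_mx ratr p.2).
pose F k := if unpickle k is Some p then
  (if `[< bx p `<=` U >] then bx p else set0) else set0.
rewrite (_ : U = \bigcup_k F k).
  apply: leb_measurable_bigcup => k; rewrite /F.
  case: unpickle => [p|]; last exact: leb_measurable0.
  by case: ifP => _; [exact: leb_measurable_box|exact: leb_measurable0].
apply/seteqP; split=> [x Ux|x [k _]]; last first.
  by rewrite /F; case: unpickle => // p; case: asboolP => // + px; exact.
have [e e0 xeU] := oU _ Ux.
have dl0 : 0 < e / d.+2%:R by rewrite divr_gt0.
set dl := e / d.+2%:R in dl0.
have /choice[q qx] : forall i, exists q : rat, x ord0 i - dl < ratr q < x ord0 i.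
  move=> i; have [|q qx] := @rat_in_itvoo R (x ord0 i - dl) (x ord0 i).
    by rewrite ltrBlDr ltrDl.
  by exists q; move: qx; rewrite in_itv.
have /choice[r rx] : forall i, exists q : rat, x ord0 i < ratr q < x ord0 i + dl.
  move=> i; have [|p px] := @rat_in_itvoo R (x ord0 i) (x ord0 i + dl).
    by rewrite ltrDl.
  by exists p; move: px; rewrite in_itv.
pose p : 'rV[rat]_d.+1 * 'rV[rat]_d.+1 := (\row_i q i, \row_i r i).
have pU : bx p `<=` U.
  move=> y py; apply: xeU; apply: (@le_lt_trans _ _ (d.+1%:R * dl)).
    apply: enorm_le_coord => [i|]; last exact: ltW.
    have := py i; have := qx i; have := rx i; rewrite !mxE ler_norml; lra.
  by rewrite /dl mulrCA gtr_pMr// ltr_pdivrMr// mul1r ltr_nat.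
exists (pickle p) => //; rewrite /F pickleK asboolT// => i.
by have := qx i; have := rx i; rewrite !mxE => /andP[/ltW-> _] /andP[_ /ltW->].
Qed.

Lemma leb_measurable_closed (U : set V) : closed U -> leb_measurable U.
Proof.
move=> cU; rewrite -(setCK U); apply/leb_measurableC/leb_measurable_open.
exact: closed_openC.
Qed.

End Measurability.

(** * Approximation from outside and continuity from below *)

Section Regularity.
Context {R : realType} {d : nat}.
Local Notation V := 'rV[R]_d.+1.
Local Notation mu := (@leb_outer R d.+1).
Implicit Types (E F : set V).

(** The product is a polynomial in [t], hence continuous at 0. It absorbs the excess of widened
    boxes, of grids overshooting a box, and of cubes enlarged by a factor [1 + t]. *)
Lemma prodr_addr_approx n (w : 'I_n -> R) (e : R) : 0 < e ->
  exists2 h : R, 0 < h & forall t, 0 <= t <= h ->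
    \prod_(i < n) (w i + t) <= \prod_(i < n) w i + e.
Proof.
move=> e0; pose p : {poly R} := \prod_(i < n) ((w i)%:P + 'X).
have pE t : p.[t] = \prod_(i < n) (w i + t).
  by rewrite horner_prod; apply: eq_bigr => i _; rewrite !hornerE.
have /cvgrPdist_le/(_ e e0)/nbhs_ballP[r /= r0 pr] := @continuous_horner _ p 0.
exists (r / 2) => [|t /andP[t0 tr]]; first by rewrite divr_gt0.
have /pr : ball (0 : R) r t.
  rewrite /ball/= sub0r normrN ger0_norm//; lra.
rewrite !pE ler_norml => /andP[+ _].
under [X in _ <= X - _]eq_bigr do rewrite addr0.
lra.
Qed.

Lemma box_vol_widen (a b : V) (e : R) : 0 < e ->
  exists2 h : R, 0 < h &
    box_vol (\row_i (a ord0 i - h)) (\row_i (b ord0 i + h)) <= box_vol a b + e.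
Proof.
move=> e0.
have [h h0 /(_ h)] := prodr_addr_approx _ (fun i => b ord0 i - a ord0 i) _ e0.
rewrite ltW// lexx => /(_ isT) H.
exists (h / 2); first by rewrite divr_gt0.
apply: le_trans H; rewrite le_eqVlt; apply/orP; left; apply/eqP.
by apply: eq_bigr => i _; rewrite !mxE; field.
Qed.

Lemma leb_outer_open E (e : R) : 0 < e ->
  exists O : set V, [/\ open O, E `<=` O & (mu O <= mu E + e%:E)%E].
Proof.
move=> e0; have [Eoo|Efin] := eqVneq (mu E) +oo%E.
  by exists setT; split; [exact: openT|by []|rewrite Eoo leey].
have e20 : 0 < e / 2 by rewrite divr_gt0.
have [|a [b [[ab Eab] ablt]]] := @leb_outer_approx R d E _ _ e20.
  by rewrite ltey.
have /choice[h hP] k : exists h, 0 < h /\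
    box_vol (\row_i (a k ord0 i - h)) (\row_i (b k ord0 i + h)) <=
    box_vol (a k) (b k) + e / 2 / (2 ^ k.+1)%:R.
  have [|h h0 hP] := box_vol_widen (a k) (b k) (e / 2 / (2 ^ k.+1)%:R).
    by rewrite divr_gt0// ltr0n expn_gt0.
  by exists h.
pose O := \bigcup_k [set x | exists2 y, box (a k) (b k) y & enorm (x - y) < h k].
exists O; split.
- apply: bigcup_open => k _; apply/open_enormP => x [y yab xy].
  exists (h k - enorm (x - y)) => [|z zx]; first by rewrite subr_gt0.
  by exists y => //; have := ler_edist_add x z y; lra.
- move=> x /Eab[k _ xab]; exists k => //; exists x => //.
  by rewrite subrr enorm0; exact: (hP k).1.
have abh k i : (\row_i (a k ord0 i - h k) : V) ord0 i <=
    (\row_i (b k ord0 i + h k) : V) ord0 i.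
  by rewrite !mxE; have := ab k i; have := (hP k).1; lra.
apply: (@le_trans _ _ (\sum_(0 <= k <oo) ((box_vol (a k) (b k))%:E +
    (e / 2 / (2 ^ k.+1)%:R)%:E))%E).
  apply: le_trans (leb_outer_le_cover _ (fun k => \row_i (a k ord0 i - h k))
    (fun k => \row_i (b k ord0 i + h k)) _) _.
    split=> [//|x [k _ [y yab xy]]]; exists k => // i; rewrite !mxE.
    have /andP[] := yab i; have := coord_le_enorm (x - y) i.
    by rewrite !mxE ler_norml => /andP[]; lra.
  apply: lee_nneseries => k *; first by rewrite lee_fin box_vol_ge0.
  by rewrite -EFinD lee_fin; exact: (hP k).2.
apply: le_trans (epsilon_trick _ _ (ltW e20)) _.
  by move=> k; rewrite lee_fin box_vol_ge0.
apply: le_trans (leeD2r _ ablt) _.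
by rewrite -addeA -EFinD -splitr.
Qed.

Lemma leb_outer_hull E :
  exists G : set V, [/\ leb_measurable G, E `<=` G & mu G = mu E].
Proof.
have /choice[U UP] : forall k, exists U : set V,
    [/\ open U, E `<=` U & (mu U <= mu E + (k.+1%:R^-1)%:E)%E].
  by move=> k; apply: leb_outer_open; rewrite invr_gt0.
exists (\bigcap_k U k); split.
- by apply: leb_measurable_bigcap => k; apply: leb_measurable_open; case: (UP k).
- by move=> x Ex k _; case: (UP k) => _ + _; apply.
apply/eqP; rewrite eq_le; apply/andP; split; last first.
  by apply: le_leb_outer => x Ex k _; case: (UP k) => _ + _; apply.
apply/lee_addgt0Pr => e e0.
have [k _ ke] := @near_infty_natSinv_lt R (PosNum e0) .
have [_ _ Uk] := UP k; apply: (@le_trans _ _ (mu (U k))).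
  by apply: le_leb_outer; exact: bigcap_inf.
apply: le_trans Uk _; rewrite leeD2l// lee_fin ltW//.
exact: (ke k (leqnn k)).
Qed.

(** Measurable hulls [G k] need not increase with [k], but the tail intersections [B k] do. They
    still contain [A k] and have its measure as a bound, so continuity from below of a measure
    applies to them. *)
Lemma leb_outer_nondecreasing (A : nat -> set V) (c : \bar R) :
  {homo A : k m / (k <= m)%N >-> k `<=` m} -> (forall k, (mu (A k) <= c)%E) ->
  (mu (\bigcup_k A k) <= c)%E.
Proof.
move=> ndA Ac; have /choice[G GP] := fun k => leb_outer_hull (A k).
pose B k := \bigcap_(m in [set m | (k <= m)%N]) G m.
have mB k : leb_measurable (B k).
  rewrite (_ : B k = \bigcap_m (G (k + m)%N)).
    by apply: leb_measurable_bigcap => m; case: (GP (k + m)%N).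
  apply/seteqP; split=> [x Bx m _|x Bx m /= km]; first by apply: Bx; rewrite /= leq_addr.
  by have := Bx (m - k)%N Logic.I; rewrite subnKC.
have AB k : A k `<=` B k.
  by move=> x Ax m /= km; case: (GP m) => _ + _; apply; exact: ndA km _ Ax.
have Bc k : (mu (B k) <= c)%E.
  apply: le_trans (Ac k); case: (GP k) => _ _ <-; apply: le_leb_outer => x.
  by apply => /=.
apply: (@le_trans _ _ (mu (\bigcup_k B k))).
  by apply: le_leb_outer => x [k _ /AB Bx]; exists k.
have ndB : nondecreasing_seq B.
  move=> k m km; apply/subsetPset => x Bx l /= ml; apply: Bx => /=.
  exact: leq_trans ml.
pose om : {outer_measure set V -> \bar R} := mu.
have muB : mu \o B @ \oo --> mu (\bigcup_k B k) :=
  @nondecreasing_cvg_mu _ (caratheodory_type om) R om B mB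
    (leb_measurable_bigcup _ mB) ndB.
rewrite -(cvg_lim (@ereal_hausdorff R) muB); apply: lime_le.
  by apply/cvg_ex; exists (mu (\bigcup_k B k)).
by near=> k; exact: Bc.
Unshelve. all: by end_near. Qed.

End Regularity.

(** * Reduction of image estimates to small cubes *)

Section CubeCover.
Context {R : realType} {d : nat}.
Local Notation V := 'rV[R]_d.+1.
Local Notation mu := (@leb_outer R d.+1).
Implicit Types (E F : set V).

Lemma leb_outer_fin_subadditive (T : eqType) (s : seq T) (F : T -> set V) :
  (mu [set x | exists2 t, t \in s & F t x] <= \sum_(t <- s) mu (F t))%E.
Proof.
elim: s => [|t s IHs].
  rewrite big_nil (_ : [set x | _] = set0) ?leb_outer0//.
  by apply/seteqP; split=> x // -[].
rewrite big_cons; apply: (@le_trans _ _ (mu (F t `|`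
  [set x | exists2 t, t \in s & F t x]))%E).
  apply: le_leb_outer => x [u]; rewrite inE => /orP[/eqP->|us] Fu; [by left|].
  by right; exists u.
by apply: le_trans (leb_outerU2 _ _) _; rewrite leeD2l.
Qed.

(** The box is covered by a grid of cubes of side [dl], which overshoots it by at most [dl] in each
    direction; the extra volume vanishes with [dl]. *)
Lemma leb_outer_image_box (X : set V) (f : V -> V) (C dl0 : R) :
  0 < C -> 0 < dl0 ->
  (forall (a : V) (dl : R), 0 < dl -> dl <= dl0 ->
    (mu (f @` (X `&` box a (a + const_mx dl))) <= (C * dl ^+ d.+1)%:E)%E) ->
  forall a b : V, (forall i, a ord0 i <= b ord0 i) ->
  (mu (f @` (X `&` box a b)) <= (C * box_vol a b)%:E)%E.
Proof.
move=> C0 dl00 fC a b ab; apply/lee_addgt0Pr => e e0.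
have eC0 : 0 < e / C by rewrite divr_gt0.
have [h h0 hP] := prodr_addr_approx _ (fun i => b ord0 i - a ord0 i) _ eC0.
pose dl := Num.min h dl0.
have dlp : 0 < dl by rewrite lt_min h0.
pose w i := (b ord0 i - a ord0 i) / dl.
have w0 i : 0 <= w i by rewrite divr_ge0 ?subr_ge0// ltW.
pose M i := (Num.truncn (w i)).+1.
(* A common bound lets cells be indexed by functions into one finite type; indices beyond [M i] on
   some axis get the empty cell. *)
pose N := \max_i M i.
have MN i : (M i <= N.+1)%N by rewrite ltnW// ltnS; exact: leq_bigmax.
pose corner (g : {ffun 'I_d.+1 -> 'I_N.+1}) : V := \row_i (a ord0 i + dl * (g i)%:R).
pose cell (g : {ffun 'I_d.+1 -> 'I_N.+1}) : set V := if [forall i, (g i < M i)%N] then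
  f @` (X `&` box (corner g) (corner g + const_mx dl)) else set0.
apply: (@le_trans _ _ (\sum_(g : {ffun 'I_d.+1 -> 'I_N.+1})
    (C * \prod_i (if (g i < M i)%N then dl else 0))%:E)%E).
  apply: (@le_trans _ _ (\sum_(g : {ffun 'I_d.+1 -> 'I_N.+1}) mu (cell g))%E).
    rewrite -big_enum/=; apply: le_trans (leb_outer_fin_subadditive _ _ _).
    apply: le_leb_outer => _ [x [Xx xab] <-].
    have tr i : (Num.truncn ((x ord0 i - a ord0 i) / dl) < M i)%N.
      rewrite /M ltnS; apply: le_truncn; rewrite ler_pM2r ?invr_gt0// lerD2r.
      by case/andP: (xab i).
    have trN i : (Num.truncn ((x ord0 i - a ord0 i) / dl) < N.+1)%N.
      exact: leq_trans (tr i) (MN i).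
    exists [ffun i => Ordinal (trN i)]; first by rewrite mem_enum.
    rewrite /cell ifT; last by apply/forallP => i; rewrite ffunE /=.
    exists x => //; split=> // i; rewrite !mxE ffunE /=.
    have /truncn_itv /andP[] : 0 <= (x ord0 i - a ord0 i) / dl.
      by rewrite divr_ge0 ?(ltW dlp)// subr_ge0; case/andP: (xab i).
    rewrite ler_pdivlMr// ltr_pdivrMr// -natr1 => H1 H2; lra.
  apply: lee_sum => g _; rewrite /cell; case: ifPn => [/forallP gM|].
    rewrite (eq_bigr (fun=> dl)) => [|i _]; last by rewrite gM.
    by rewrite prodr_const card_ord; apply: fC => //; rewrite ge_min lexx orbT.
  move=> /forallPn[i /negbTE giM]; rewrite leb_outer0 lee_fin.
  by rewrite (bigD1 i)//= giM mul0r mulr0.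
rewrite sumEFin -EFinD lee_fin -mulr_sumr.
(* The sum over cells factors as a product over the axes; axis [i] contributes [M i] times [dl], at
   most the side length plus [dl]. *)
rewrite -(bigA_distr_bigA (fun i (j : 'I_N.+1) => if (j < M i)%N then dl else 0)).
apply: (@le_trans _ _ (C * \prod_i (b ord0 i - a ord0 i + dl))).
  apply: ler_wpM2l; first exact: ltW.
  apply: ler_prod => i _; rewrite -big_mkcond/= (big_ord_narrow (MN i))/=.
  rewrite sumr_const card_ord.
  rewrite mulrn_wge0 ?(ltW dlp)//= /M mulrSr lerD2r -mulr_natl -ler_pdivlMr//.
  by case/andP: (truncn_itv (w0 i)).
have : \prod_i (b ord0 i - a ord0 i + dl) <= box_vol a b + e / C.
  by apply: hP; rewrite (ltW dlp) ge_min lexx.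
move=> /(ler_wpM2l (ltW C0)); rewrite mulrDr [C * (e / C)]mulrC divfK//.
exact: lt0r_neq0.
Qed.

Lemma leb_outer_image_le (X : set V) (f : V -> V) (C dl0 : R) :
  0 < C -> 0 < dl0 ->
  (forall (a : V) (dl : R), 0 < dl -> dl <= dl0 ->
    (mu (f @` (X `&` box a (a + const_mx dl))) <= (C * dl ^+ d.+1)%:E)%E) ->
  (mu (f @` X) <= C%:E * mu X)%E.
Proof.
move=> C0 dl00 fC; have [Xoo|Xfin] := eqVneq (mu X) +oo%E.
  by rewrite Xoo mulry gtr0_sg// mul1e leey.
apply/lee_addgt0Pr => e e0.
have [||a [b [[ab Xab] ablt]]] := @leb_outer_approx R d X (e / C).
- by rewrite ltey.
- by rewrite divr_gt0.
apply: (@le_trans _ _ (C%:E * \sum_(0 <= k <oo) (box_vol (a k) (b k))%:E)%E).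
  rewrite -nneseriesZl; last by move=> k _; rewrite lee_fin box_vol_ge0.
  apply: (@le_trans _ _ (\sum_(0 <= k <oo) mu (f @` (X `&` box (a k) (b k))))%E).
    apply: le_trans (leb_outer_sigma_subadditive _).
    apply: le_leb_outer => _ [x Xx <-]; have [k _ xab] := Xab _ Xx.
    by exists k => //; exists x.
  apply: lee_nneseries => k *; first exact: leb_outer_ge0.
  by rewrite -EFinM; apply: (leb_outer_image_box _ _ _ _ C0 dl00 fC).
apply: le_trans (lee_wpmul2l _ ablt) _; first by rewrite lee_fin ltW.
rewrite ge0_muleDr ?leb_outer_ge0 ?lee_fin ?(ltW (divr_gt0 e0 C0))//.
by rewrite -EFinM [C * (e / C)]mulrC divfK// lt0r_neq0.
Qed.

End CubeCover.

(** * Linear images *)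

Section LinearImage.
Context {R : realType} {d : nat}.
Local Notation V := 'rV[R]_d.+1.
Local Notation mu := (@leb_outer R d.+1).
Implicit Types (E F : set V).

Lemma lee_scale_limit (x y : \bar R) (C : R) : (0 <= y)%E -> 0 < C ->
  (forall e : R, 0 < e -> (x <= (C + e)%:E * y)%E) -> (x <= C%:E * y)%E.
Proof.
case: y => [r| |//] r0 C0 H; last by rewrite mulry gtr0_sg// mul1e leey.
rewrite lee_fin in r0; apply/lee_addgt0Pr => e e0.
have r10 : 0 < r + 1 by rewrite ltr_wpDl.
apply: le_trans (H (e / (r + 1)) _) _; first by rewrite divr_gt0.
rewrite -!EFinM -EFinD lee_fin mulrDl lerD2l -mulrA ger_pMr//.
by rewrite mulrC ler_pdivrMr// mul1r lerDl.
Qed.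

Lemma leb_outer_cube (a : V) (s : R) : 0 <= s ->
  (mu (box a (a + const_mx s)) <= (s ^+ d.+1)%:E)%E.
Proof.
move=> s0; apply: le_trans (leb_outer_box _ _ _) _ => [i|].
  by rewrite !mxE lerDl.
rewrite lee_fin /box_vol (eq_bigr (fun=> s)) ?prodr_const ?card_ord// => i _.
by rewrite !mxE; ring.
Qed.

(** Multiplication by a matrix that is the identity except for its column [i], which is [c]: the
    elementary factor of a triangular matrix. *)
Definition coord_map (i : 'I_d.+1) (c x : V) : V := rowset x i (dot c x).

(** A cube of side [dl] goes into a box with the same sides except in direction [i], where the
    linear form varies by at most [K * dl]. *)
Lemma leb_outer_coord_map_crude i (c : V) E : 0 < \sum_j `|c ord0 j| ->
  (mu (coord_map i c @` E) <= (\sum_j `|c ord0 j|)%:E * mu E)%E.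
Proof.
set K := \sum_j _ => K0; apply: (leb_outer_image_le E _ K 1) => // a dl dl0 _.
pose m : V := a + const_mx (dl / 2).
pose a' := rowset a i (dot c m - K * (dl / 2)).
pose b' := rowset (a + const_mx dl) i (dot c m + K * (dl / 2)).
apply: (@le_trans _ _ (mu (box a' b'))).
  apply: le_leb_outer => _ [x [_ xa] <-] j; rewrite !mxE.
  case: eqP => _; last by have := xa j; rewrite !mxE.
  have : `|dot c (x - m)| <= K * (dl / 2).
    rewrite mulr_suml; apply: le_trans (ler_norm_sum _ _ _) _.
    apply: ler_sum => k _; rewrite normrM; apply: ler_wpM2l => //.
    by have := xa k; rewrite !mxE ler_norml; lra.
  by rewrite !dotE ler_norml; lra.
apply: le_trans (leb_outer_box _ _ _) _ => [j|].
  rewrite !mxE; case: eqP => _; last by rewrite lerDl ltW.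
  have : 0 <= K * (dl / 2) by rewrite mulr_ge0 ?divr_ge0 ?ltW.
  lra.
rewrite lee_fin (box_volD1 _ _ i) !mxE eqxx (eq_bigr (fun=> dl)); last first.
  by move=> j /negbTE ji; rewrite !mxE ji; ring.
rewrite prodr_const cardC1 card_ord exprS le_eqVlt; apply/orP; left; apply/eqP.
by rewrite mulrA; congr (_ * _); field.
Qed.

(* Conjugating with the scaling of coordinate [i] by [t] multiplies the other
   entries of [c] by [t], so letting [t] tend to [0] improves the crude bound. *)
Lemma leb_outer_coord_map i (c : V) E : c ord0 i != 0 ->
  (mu (coord_map i c @` E) <= `|c ord0 i|%:E * mu E)%E.
Proof.
move=> ci0; apply: lee_scale_limit; [exact: leb_outer_ge0|by rewrite normr_gt0|].
move=> e e0; set S := \sum_(j | j != i) `|c ord0 j|.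
have S0 : 0 <= S by exact: sumr_ge0.
pose t := e / (S + 1).
have t0 : 0 < t by rewrite divr_gt0// ltr_wpDl.
pose sc (r : R) : V := \row_j (if j == i then r else 0).
pose c' : V := \row_j (if j == i then c ord0 i else t * c ord0 j).
have sum_sc r : \sum_j `|sc r ord0 j| = `|r|.
  rewrite (bigD1 i)//= mxE eqxx big1 ?addr0// => j /negbTE ji.
  by rewrite mxE ji normr0.
have sum_c' : \sum_j `|c' ord0 j| = `|c ord0 i| + t * S.
  rewrite (bigD1 i)//= mxE eqxx mulr_sumr; congr (_ + _); apply: eq_bigr => j.
  by move=> /negbTE ji; rewrite mxE ji normrM gtr0_norm.
have dot_sc r x : dot (sc r) x = r * x ord0 i.
  rewrite /dot (bigD1 i)//= mxE eqxx big1 ?addr0// => j /negbTE ji.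
  by rewrite mxE ji mul0r.
have -> : coord_map i c =
    coord_map i (sc t^-1) \o coord_map i c' \o coord_map i (sc t).
  apply/funext => x; apply/rowP => j; rewrite !mxE !dot_sc; case: eqP => // _.
  rewrite !mxE eqxx /dot !(bigD1 i (P := xpredT))//= !mxE eqxx mulrDr.
  congr (_ + _); first by rewrite dot_sc; field; rewrite gt_eqF.
  rewrite mulr_sumr; apply: eq_bigr => k /negbTE ki.
  by rewrite !mxE ki -mulrA mulKf// gt_eqF.
rewrite [X in mu X](_ : _ = coord_map i (sc t^-1) @` (coord_map i c' @`
  (coord_map i (sc t) @` E))); last by rewrite !image_comp.
have tn : `|t| = t by rewrite gtr0_norm.
have tVn : `|t^-1| = t^-1 by rewrite gtr0_norm ?invr_gt0.
apply: le_trans (leb_outer_coord_map_crude _ _ _ _) _.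
  by rewrite sum_sc tVn invr_gt0.
rewrite sum_sc tVn; have tV0 : (0 <= t^-1%:E)%E by rewrite lee_fin invr_ge0 ltW.
apply: le_trans (lee_wpmul2l tV0 (leb_outer_coord_map_crude _ _ _ _)) _.
  by rewrite sum_c' ltr_wpDr ?normr_gt0// mulr_ge0// ltW.
rewrite sum_c' muleA -EFinM; have c0 : (0 <= (t^-1 * (`|c ord0 i| + t * S))%:E)%E.
  rewrite lee_fin; apply: mulr_ge0; first by rewrite invr_ge0 ltW.
  by apply: addr_ge0 => //; apply: mulr_ge0 => //; exact: ltW.
apply: le_trans (lee_wpmul2l c0 (leb_outer_coord_map_crude _ _ _ _)) _.
  by rewrite sum_sc tn.
rewrite sum_sc tn muleA -EFinM; apply: lee_wpmul2r; first exact: leb_outer_ge0.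
rewrite lee_fin mulrAC mulVf ?gt_eqF// mul1r lerD2l /t mulrAC ler_pdivrMr ?ltr_wpDl//.
by rewrite ler_pM2l// lerDl.
Qed.

(* Replacing the coordinates of [x] by those of [x *m A] one at a time, in an
   order in which each entry only involves coordinates not yet replaced. *)
Lemma leb_outer_triangular (A : 'M[R]_d.+1) (s : seq 'I_d.+1) E :
  (forall i, A i i != 0) -> uniq s -> pairwise (fun k i => A i k == 0) s ->
  (mu ((fun x : V => \row_j (if j \in s then (x *m A) ord0 j else x ord0 j) : V) @` E)
    <= (\prod_(i <- s) `|A i i|)%:E * mu E)%E.
Proof.
move=> A0; elim: s => [|k s IHs].
  move=> _ _; rewrite big_nil mul1e; apply: le_leb_outer => _ [x Ex <-].
  by rewrite (_ : \row_j _ = x)//; apply/rowP => j; rewrite mxE.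
move=> /= /andP[ks us] /andP[/allP Ak ps]; rewrite big_cons EFinM -muleA.
apply: le_trans (lee_wpmul2l _ (IHs us ps)); last by rewrite lee_fin.
pose c : V := \row_i A i k.
have ck : c ord0 k = A k k by rewrite mxE.
rewrite -ck; apply: le_trans (leb_outer_coord_map k c _ _); last by rewrite ck.
rewrite image_comp; apply: le_leb_outer => _ [x Ex <-]; exists x => //=.
apply/rowP => j; rewrite !mxE inE; case: eqP => [->|_]//=.
rewrite /dot; apply: eq_bigr => i _; rewrite !mxE.
case: ifP => [/Ak/eqP ->|_]; first by rewrite mul0r mulr0.
by rewrite mulrC.
Qed.

Lemma leb_outer_perm_mx (s : 'S_d.+1) E :
  (mu ((fun x : V => x *m perm_mx s) @` E) <= mu E)%E.
Proof.
rewrite -[leRHS]mul1e; apply: (leb_outer_image_le E _ 1 1) => // a dl dl0 _.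
rewrite mul1r; apply: le_trans (leb_outer_cube (col_perm s^-1 a) _ (ltW dl0)).
apply: le_leb_outer => _ [x [_ xa] <-] j.
by have := xa (s^-1%g j); rewrite -[s in perm_mx s]invgK -col_permE !mxE.
Qed.

(** LUP decomposition: the permutation sends cubes to cubes, [L] has unit diagonal, and the diagonal
    of [U] accounts for the absolute determinant. *)
Lemma leb_outer_mulmx (A : 'M[R]_d.+1) E : \det A != 0 ->
  (mu ((fun x : V => x *m A) @` E) <= `|\det A|%:E * mu E)%E.
Proof.
move=> A0; have := cormen_lup_correct A; have := cormen_lup_perm A.
have := cormen_lup_detL A; have := fun i j => @cormen_lup_lower _ _ A i j.
have := fun i j => @cormen_lup_upper _ _ A i j.
case: (cormen_lup A) => [[P L] U] /= upU lowL detL /is_perm_mxP[s ->{P}] PALU.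
have AE : A = perm_mx s^-1 *m L *m U.
  have : perm_mx s *m A = L *m U := PALU.
  move=> /(congr1 (mulmx (perm_mx s^-1))).
  by rewrite !mulmxA -perm_mxM mulVg perm_mx1 mul1mx.
have detU : \det U = \prod_i U i i.
  rewrite -det_tr det_trig; first by apply: eq_bigr => i _; rewrite mxE.
  by apply/is_trig_mxP => i j ij; rewrite mxE upU.
have dAU : `|\det A| = \prod_i `|U i i|.
  by rewrite AE !det_mulmx det_perm detL mulr1 normrM normrX normrN1 expr1n mul1r
    detU normr_prod.
have U0 i : U i i != 0.
  apply: contraNneq A0 => Ui0; rewrite -normr_eq0 dAU (bigD1 i)//= Ui0.
  by rewrite normr0 mul0r.
have L1 i : L i i = 1 by rewrite lowL// eqxx.
have permute (s' : seq 'I_d.+1) (B : 'M[R]_d.+1) F : (forall i, i \in s') ->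
    (fun x : V => \row_j (if j \in s' then (x *m B) ord0 j else x ord0 j) : V) @` F
    = (fun x : V => x *m B) @` F.
  move=> s'all; apply: eq_imagel => x _; apply/rowP => j.
  by rewrite mxE s'all.
(* In [leb_outer_triangular] the tail of the list is replaced before its head. A new coordinate of
   [x *m U] uses only earlier or equal indices, so the increasing enumeration fits; for [L] it is
   reversed. *)
have ltn_enum : sorted (fun i j : 'I_d.+1 => (i < j)%N) (enum 'I_d.+1).
  by have := iota_ltn_sorted 0 d.+1; rewrite -val_enum_ord sorted_map.
have stepU F : (mu ((fun x : V => x *m U) @` F) <= `|\det A|%:E * mu F)%E.
  rewrite -(permute (enum 'I_d.+1)) => [|i]; last by rewrite mem_enum.
  rewrite dAU -big_enum; apply: leb_outer_triangular; [exact: U0|exact: enum_uniq|].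
  move: ltn_enum; rewrite sorted_pairwise; last by move=> ? ? ?; exact: ltn_trans.
  by apply: sub_pairwise => i j ij; rewrite upU.
have stepL F : (mu ((fun x : V => x *m L) @` F) <= mu F)%E.
  rewrite -(permute (rev (enum 'I_d.+1))) => [|i]; last by rewrite mem_rev mem_enum.
  apply: le_trans (leb_outer_triangular L _ F _ _ _) _.
  - by move=> i; rewrite L1 oner_eq0.
  - by rewrite rev_uniq enum_uniq.
  - move: ltn_enum; rewrite -[X in sorted _ X]revK rev_sorted sorted_pairwise.
      apply: sub_pairwise => i j /= ij; rewrite lowL ?(ltnW ij)//.
      by rewrite -val_eqE/= ltn_eqF.
    by move=> i j k /= ij ki; exact: ltn_trans ki ij.
  by rewrite big1 ?mul1e// => i _; rewrite L1 normr1.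
rewrite (_ : (fun x : V => x *m A) @` E =
  (fun x : V => x *m U) @` ((fun x : V => x *m L) @` ((fun x : V => x *m perm_mx s^-1) @` E))); last first.
  by rewrite !image_comp; apply: eq_imagel => x _ /=; rewrite AE !mulmxA.
apply: le_trans (stepU _) _; apply: lee_wpmul2l; first by rewrite lee_fin.
by apply: le_trans (stepL _) _; exact: leb_outer_perm_mx.
Qed.

(** The matrix fixes [n] and is [l] on its orthogonal complement. The determinant of the bordered
    matrix [X] is computed by eliminating either off-diagonal block, giving the left side once and
    $l^{d+1}\cdot l^{-1}$ once. *)
Lemma det_scalar_sub_rank1 (n : V) (l : R) : dot n n = 1 -> l != 0 ->
  \det (l%:M - (l - 1) *: (n^T *m n)) = l ^+ d.
Proof.
move=> n1 l0; have nn : (n *m n^T = 1%:M :> 'M[R]_1).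
  rewrite [LHS]mx11_scalar mxE; congr (_ %:M); rewrite -n1.
  by apply: eq_bigr => i _; rewrite mxE.
pose X : 'M[R]_(d.+1 + 1) := block_mx l%:M n^T ((l - 1) *: n) 1%:M.
have e1 : X *m block_mx 1%:M 0 (- (l - 1) *: n) 1%:M =
    block_mx (l%:M - (l - 1) *: (n^T *m n)) n^T 0 1%:M.
  rewrite mulmx_block !mulmx1 !mul1mx !mulmx0 !add0r -!scalemxAr scaleNr.
  by rewrite scaleNr subrr.
have e2 : block_mx 1%:M 0 (- ((l - 1) / l) *: n) 1%:M *m X =
    block_mx l%:M n^T 0 (l^-1)%:M.
  rewrite mulmx_block !mul1mx !mul0mx !addr0 -!scalemxAl nn mul_mx_scalar scalerA.
  congr block_mx.
    by rewrite -scalerDl mulNr divfK// addNr scale0r.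
  by apply/matrixP => i j; rewrite !ord1 !mxE eqxx /=; field.
move/(congr1 determinant): e1; rewrite det_mulmx det_lblock det_ublock !det1 !mulr1 => <-.
move/(congr1 determinant): e2; rewrite det_mulmx det_lblock det_ublock !det1 !mul1r => ->.
by rewrite !det_scalar expr1 exprS mulrAC divff// mul1r.
Qed.

End LinearImage.

(** * Radial displacement from a point *)

Section RadialPush.
Context {R : realType} {d : nat}.
Local Notation V := 'rV[R]_d.+1.
Local Notation mu := (@leb_outer R d.+1).
Implicit Types (E F X : set V).

(* [pull] and [push] are the approach map of [[set h]] and its inverse. *)
Definition push (h : V) (D : R) (y : V) : V := y + (D / enorm (y - h)) *: (y - h).
Definition pull (h : V) (D : R) (x : V) : V := x + (D / enorm (h - x)) *: (h - x).

Lemma pull_sub h D x : pull h D x - h = (1 - D / enorm (x - h)) *: (x - h).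
Proof.
rewrite /pull enorm_sym -[h - x]opprB scalerN scalerBl scale1r.
by rewrite addrAC.
Qed.

Lemma enorm_pull h D x : 0 <= D -> D <= enorm (x - h) -> 0 < enorm (x - h) ->
  enorm (pull h D x - h) = enorm (x - h) - D.
Proof.
move=> D0 Dx x0; rewrite pull_sub enormZ ger0_norm.
  by rewrite mulrBl mul1r divfK// gt_eqF.
by rewrite subr_ge0 ler_pdivrMr// mul1r.
Qed.

Lemma enorm_pull_sub h D x : 0 <= D -> 0 < enorm (x - h) ->
  enorm (pull h D x - x) = D.
Proof.
move=> D0 x0; rewrite /pull addrAC subrr add0r enormZ enorm_sym.
by rewrite ger0_norm ?divr_ge0 ?enorm_ge0// divfK// gt_eqF.
Qed.

Lemma pullK h D x : 0 <= D -> D < enorm (x - h) -> push h D (pull h D x) = x.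
Proof.
move=> D0 Dx; have x0 : 0 < enorm (x - h) by exact: le_lt_trans Dx.
rewrite /push enorm_pull// ?(ltW Dx)// pull_sub /pull enorm_sym.
rewrite -[h - x]opprB scalerN scalerA -addrA -scaleNr -scalerDl.
rewrite [X in X *: _](_ : _ = 0) ?scale0r ?addr0//.
by field; rewrite !gt_eqF// subr_gt0.
Qed.

Lemma leb_outer_translate (c : V) E : (mu ((fun x => c + x)%R @` E) <= mu E)%E.
Proof.
rewrite -[leRHS]mul1e; apply: (leb_outer_image_le E _ 1 1) => // a dl dl0 _.
rewrite mul1r; apply: le_trans (leb_outer_cube (c + a) _ (ltW dl0)).
apply: le_leb_outer => _ [x [_ xa] <-] j.
by have := xa j; rewrite !mxE; lra.
Qed.

(* [r] and [s] are the lengths of [w] and [w + v], and [a] is the component of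
   [v] along [w]. *)
Lemma radial_remainder (a r s V2 : R) : 0 < r -> 0 < s -> 0 <= V2 ->
  s ^+ 2 = r ^+ 2 + 2 * r * a + V2 ^+ 2 -> `|a| <= V2 -> `|s - r| <= V2 ->
  `|r / s - 1 + a / r| <= 3 * V2 ^+ 2 / (r * s).
Proof.
move=> r0 s0 V0 sE aV srV.
have -> : r / s - 1 + a / r = (r * (r - s) + a * s) / (r * s).
  by field; rewrite !gt_eqF.
have rsV0 : 0 < (r * s)^-1 by rewrite invr_gt0 mulr_gt0.
rewrite normrM (gtr0_norm rsV0) (ler_pM2r rsV0).
have rs0 : 0 < r + s by rewrite addr_gt0.
(* The factor [r + s] brings in $r^2-s^2$, which [sE] makes explicit: the first-order terms cancel,
   and what is left is quadratic in the displacement. *)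
have E : (r * (r - s) + a * s) * (r + s) = a * (s - r) * (s + 2 * r) - r * V2 ^+ 2.
  have -> : (r * (r - s) + a * s) * (r + s) =
    r * (r ^+ 2 - s ^+ 2) + a * s * (r + s) by ring.
  rewrite {1}sE; ring.
rewrite -(ler_pM2r rs0) -[X in `|_| * X](gtr0_norm rs0) -normrM E.
apply: le_trans (ler_normB _ _) _.
have s2r0 : 0 < s + 2 * r by lra.
rewrite !normrM (gtr0_norm s2r0) (gtr0_norm r0) (ger0_norm V0).
have : `|a| * `|s - r| * (s + 2 * r) <= V2 * V2 * (s + 2 * r).
  apply: ler_wpM2r; first exact: ltW.
  exact: ler_pM.
have := mulr_ge0 (sqr_ge0 V2) (ltW s0).
lra.
Qed.

(** Derivative of [push] at distance [r] from the center, for [l = 1 + D / r] and [n] the unit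
    radial direction, acting on row vectors. *)
Definition push_deriv (n : V) (l : R) : 'M[R]_d.+1 := l%:M - (l - 1) *: (n^T *m n).

Lemma mul_push_deriv (v n : V) (l : R) :
  v *m push_deriv n l = l *: v - ((l - 1) * dot v n) *: n.
Proof.
rewrite /push_deriv mulmxBr mul_mx_scalar -scalemxAr mulmxA -scalerA.
rewrite [v *m n^T]mx11_scalar mul_scalar_mx mxE; congr (_ - _ *: (_ *: _)).
by apply: eq_bigr => i _; rewrite mxE.
Qed.

Lemma push_taylor (h y0 y : V) (D : R) : 0 <= D ->
  0 < enorm (y0 - h) -> 0 < enorm (y - h) ->
  forall r n, r = enorm (y0 - h) -> n = r^-1 *: (y0 - h) ->
  enorm (push h D y - push h D y0 - (y - y0) *m push_deriv n (1 + D / r)) <=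
    4 * D * enorm (y - y0) ^+ 2 / (r * enorm (y - h)).
Proof.
move=> D0 + s0 r n rE nE; rewrite -rE => r0; set s := enorm (y - h) in s0 *.
have [v vE] : {v : V | v = y - y0} by exists (y - y0).
rewrite -vE; set a := dot v n.
have wE : y0 - h = r *: n by rewrite nE scalerA divff ?scale1r// gt_eqF.
have yhE : y - h = r *: n + v.
  by rewrite -wE vE; apply/rowP => i; rewrite !mxE; ring.
have nn : dot n n = 1.
  by rewrite nE dotZl dotZr -sqr_enorm -rE expr2; field; rewrite gt_eqF.
have n1 : enorm n = 1.
  by apply/eqP; rewrite -(@eqrXn2 _ 2)// ?enorm_ge0// sqr_enorm nn expr1n.
have aV : `|a| <= enorm v.
  rewrite ler_norml; have := cauchy_schwarz v n; have := cauchy_schwarz (- v) n.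
  by rewrite dotNl enormN n1 mulr1 -/a; lra.
have sE : s ^+ 2 = r ^+ 2 + 2 * r * a + enorm v ^+ 2.
  rewrite /s !sqr_enorm yhE !dotE nn. rewrite (dotC n v) -/a; ring.
have srV : `|s - r| <= enorm v.
  rewrite ler_norml; have := ler_edist_add y0 y h; have := ler_edist_add y y0 h.
  by rewrite (enorm_sym y0 y) -vE -rE -/s; lra.
rewrite mul_push_deriv -/a /push -rE -/s yhE wE.
set e := (X in enorm X).
(* The remainder in closed form. Its two summands are quadratic in [v], with constants 1 and 3,
   whence the 4. *)
have -> : e = D *: ((s^-1 - r^-1) *: v + (r / s - 1 + a / r) *: n).
  apply/rowP => i; rewrite /e !mxE.
  have -> : y ord0 i = v ord0 i + y0 ord0 i by rewrite vE !mxE subrK.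
  by field; rewrite !gt_eqF.
rewrite enormZ (ger0_norm D0).
have bound1 : enorm ((s^-1 - r^-1) *: v) <= enorm v ^+ 2 / (r * s).
  rewrite enormZ (_ : s^-1 - r^-1 = (r - s) / (r * s)); last first.
    by field; rewrite !gt_eqF.
  have rsV0 : 0 < (r * s)^-1 by rewrite invr_gt0 mulr_gt0.
  rewrite normrM (gtr0_norm rsV0) mulrAC (ler_pM2r rsV0) expr2 distrC.
  by rewrite ler_wpM2r// enorm_ge0.
have bound2 : enorm ((r / s - 1 + a / r) *: n) <= 3 * enorm v ^+ 2 / (r * s).
  by rewrite enormZ n1 mulr1; apply: radial_remainder => //; exact: enorm_ge0.
rewrite (_ : 4 * D * _ / _ = D * (4 * enorm v ^+ 2 / (r * s))); last first.
  by rewrite -!mulrA mulrCA.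
apply: ler_wpM2l => //; apply: le_trans (ler_enormD _ _) _.
apply: le_trans (lerD bound1 bound2) _; rewrite -mulrDl.
by apply: ler_wpM2r; [rewrite invr_ge0 mulr_ge0 ?ltW|lra].
Qed.

(** For [l >= 1] the inverse of the derivative does not increase norms. The Taylor error can
    therefore be moved before the linear map, where it only widens the source cube. *)
Lemma push_deriv_solve (e n : V) (l : R) : dot n n = 1 -> 1 <= l ->
  exists2 u : V, u *m push_deriv n l = e & enorm u <= enorm e.
Proof.
move=> nn l1; have l0 : 0 < l by exact: lt_le_trans l1.
have n1 : enorm n = 1.
  by apply/eqP; rewrite -(@eqrXn2 _ 2)// ?enorm_ge0// sqr_enorm nn expr1n.
exists (l^-1 *: e + ((1 - l^-1) * dot e n) *: n).
  rewrite mul_push_deriv !dotE nn; apply/rowP => i; rewrite !mxE.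
  by field; rewrite gt_eqF.
apply: le_trans (ler_enormD _ _) _; rewrite !enormZ n1 mulr1 normrM.
have lV1 : 0 <= 1 - l^-1 by rewrite subr_ge0 invf_le1.
have lV0 : 0 <= l^-1 by rewrite invr_ge0 ltW.
rewrite (ger0_norm lV0) (ger0_norm lV1).
have en : `|dot e n| <= enorm e.
  rewrite ler_norml; have := cauchy_schwarz e n; have := cauchy_schwarz (- e) n.
  by rewrite dotNl enormN n1 mulr1; lra.
by have := ler_wpM2l lV1 en; lra.
Qed.

(** A small cube goes into a translate of the derivative's image of a slightly larger cube, and the
    derivative has determinant [l ^+ d] with [l <= L]. *)
Lemma leb_outer_push (h : V) (D rho : R) X : 0 <= D -> 0 < rho ->
  (forall y, X y -> rho <= enorm (y - h)) ->
  (mu (push h D @` X) <= ((1 + D / rho) ^+ d)%:E * mu X)%E.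
Proof.
move=> D0 rho0 Xrho; set L := 1 + D / rho.
have L1 : 1 <= L by rewrite lerDl divr_ge0// ltW.
have Ld0 : 0 < L ^+ d by rewrite exprn_gt0// (lt_le_trans _ L1).
apply: lee_scale_limit => [||e e0]; [exact: leb_outer_ge0|exact: Ld0|].
have eL0 : 0 < e / L ^+ d by rewrite divr_gt0.
have [t t0 tP] := prodr_addr_approx d.+1 (fun=> 1) _ eL0.
(* The Taylor error on a cube of side [dl] is at most [K * dl ^+ 2]: two of its points are at most
   [d.+1%:R * dl] apart, and both lie at distance at least [rho] from [h]. *)
pose K := 4 * D * d.+1%:R ^+ 2 / rho ^+ 2.
have K0 : 0 <= K by rewrite /K divr_ge0 ?exprn_ge0 ?mulr_ge0// ltW.
have K10 : 0 < 2 * K + 1 by rewrite ltr_wpDl// mulr_ge0.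
(* This bound on the side gives [2 * eta <= t * dl], so the enlarged cube has side at most
   [(1 + t) * dl]. *)
apply: (leb_outer_image_le X _ _ (t / (2 * K + 1))).
- by rewrite addr_gt0.
- by rewrite divr_gt0.
move=> a dl dl0 dlt.
have [[y0 [Xy0 y0a]]|Xa0] := pselect ((X `&` box a (a + const_mx dl)) !=set0); last first.
  rewrite (_ : X `&` _ = set0) ?image_set0 ?leb_outer0 ?lee_fin.
    by rewrite mulr_ge0 ?exprn_ge0 ?addr_ge0// ltW.
  by apply/seteqP; split=> // x Xx; apply: Xa0; exists x.
set r := enorm (y0 - h).
have r0 : 0 < r by exact: lt_le_trans (Xrho _ Xy0).
pose n := r^-1 *: (y0 - h); pose l := 1 + D / r.
have nn : dot n n = 1.
  by rewrite /n dotZl dotZr -sqr_enorm -/r expr2; field; rewrite gt_eqF.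
have l1 : 1 <= l by rewrite lerDl divr_ge0// ltW.
have lL : l <= L.
  by rewrite lerD2l ler_wpM2l// lef_pV2 ?posrE//; exact: Xrho.
pose eta := K * dl ^+ 2.
have eta0 : 0 <= eta by rewrite mulr_ge0 ?sqr_ge0.
pose c : V := a - y0 - const_mx eta.
have incl : push h D @` (X `&` box a (a + const_mx dl)) `<=`
    (fun x => push h D y0 + x) @` ((fun x => x *m push_deriv n l) @`
      box c (c + const_mx (dl + 2 * eta))).
  move=> _ [y [Xy ya] <-].
  have s0 : 0 < enorm (y - h) by exact: lt_le_trans (Xrho _ Xy).
  have := push_taylor h y0 y D D0 r0 s0 r n erefl erefl.
  rewrite -/l => tay; set er := (X in enorm X) in tay.
  have [u uE ue] := push_deriv_solve er n l nn l1.
  exists ((y - y0 + u) *m push_deriv n l); last first.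
    by rewrite mulmxDl uE /er [X in _ + X]addrC subrK addrC subrK.
  exists (y - y0 + u) => // i.
  have vdl : enorm (y - y0) <= d.+1%:R * dl.
    apply: enorm_le_coord => [j|]; last exact: ltW.
    by have := ya j; have := y0a j; rewrite !mxE ler_norml; lra.
  have : `|u ord0 i| <= eta.
    apply: le_trans (coord_le_enorm _ _) _; apply: le_trans ue _.
    apply: le_trans tay _.
    have -> : eta = 4 * D * ((d.+1%:R * dl) ^+ 2 / rho ^+ 2).
      by rewrite /eta /K; field; rewrite gt_eqF.
    rewrite -mulrA; apply: ler_wpM2l; first by rewrite mulr_ge0.
    have rs0 : 0 < r * enorm (y - h) by rewrite mulr_gt0.
    apply: ler_pM; [exact: sqr_ge0|by rewrite invr_ge0 ltW| |].
      by rewrite ler_sqr ?nnegrE ?enorm_ge0// mulr_ge0// ltW.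
    rewrite lef_pV2 ?posrE ?exprn_gt0// expr2.
    by apply: ler_pM; [exact: ltW|exact: ltW|exact: Xrho|exact: Xrho].
  by have := ya i; rewrite !mxE ler_norml; lra.
apply: le_trans (le_leb_outer _ _ incl) _.
apply: le_trans (leb_outer_translate _ _) _.
have detE : \det (push_deriv n l) = l ^+ d.
  by apply: det_scalar_sub_rank1 => //; rewrite gt_eqF// (lt_le_trans _ l1).
have l0 : 0 <= l by rewrite (le_trans _ l1).
apply: le_trans (leb_outer_mulmx _ _ _) _.
  by rewrite detE expf_neq0// gt_eqF// (lt_le_trans _ l1).
rewrite detE ger0_norm ?exprn_ge0//.
have dle0 : 0 <= dl + 2 * eta by apply: addr_ge0; [exact: ltW|exact: mulr_ge0].
apply: le_trans (lee_wpmul2l _ (leb_outer_cube _ _ dle0)) _.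
  by rewrite lee_fin exprn_ge0.
rewrite -EFinM lee_fin.
apply: (@le_trans _ _ (L ^+ d * ((1 + t) ^+ d.+1 * dl ^+ d.+1))).
  apply: ler_pM; [exact: exprn_ge0|exact: exprn_ge0| |].
    by rewrite lerXn2r ?nnegrE// (le_trans l0).
  have t10 : 0 <= 1 + t by rewrite addr_ge0// ltW.
  rewrite -exprMn lerXn2r ?nnegrE ?mulr_ge0 ?(ltW dl0)//.
  rewrite [(1 + t) * dl]mulrDl mul1r lerD2l.
  rewrite (_ : 2 * eta = 2 * K * dl * dl) ?ler_pM2r//; last by rewrite /eta; ring.
  move: dlt; rewrite ler_pdivlMr// => dlt.
  by apply: le_trans dlt; lra.
rewrite mulrA ler_pM2r ?exprn_gt0//.
have := tP t; rewrite ltW// lexx => /(_ isT).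
rewrite !prodr_const card_ord expr1n => /(ler_wpM2l (ltW Ld0)).
by rewrite mulrDr mulr1 [_ * (e / _)]mulrC divfK// gt_eqF.
Qed.

End RadialPush.

(** * Displacement towards a general set *)

Section PullInequality.
Context {R : realType} {d : nat}.
Local Notation V := 'rV[R]_d.+1.
Local Notation mu := (@leb_outer R d.+1).
Variable H : set V.
Hypothesis H0 : H !=set0.
Implicit Types (A : set V) (x y h : V) (D r : R).

Definition nearest x h := closure H h /\ enorm (x - h) = dist_pt x H.

(* The image of [A] under the approach map for all choices of nearest points. *)
Definition pulls D A : set V :=
  [set y | exists x h, [/\ A x, nearest x h & y = pull h D x]].

Lemma normalize_lipschitz (u v : V) r : 0 < r -> r <= enorm u -> 0 < enorm v ->
  enorm ((enorm u)^-1 *: u - (enorm v)^-1 *: v) <= 2 / r * enorm (u - v).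
Proof.
move=> r0 ru v0; have u0 : 0 < enorm u by exact: lt_le_trans ru.
have -> : (enorm u)^-1 *: u - (enorm v)^-1 *: v =
    (enorm u)^-1 *: (u - v) + ((enorm u)^-1 * (enorm v - enorm u) / enorm v) *: v.
  by apply/rowP => i; rewrite !mxE; field; rewrite !gt_eqF.
apply: le_trans (ler_enormD _ _) _; rewrite !enormZ !normrM !normfV.
rewrite (gtr0_norm u0) (gtr0_norm v0) divfK ?gt_eqF//.
have uv : `|enorm v - enorm u| <= enorm (u - v).
  rewrite ler_norml; have := ler_enormD (u - v) v; have := ler_enormD (v - u) u.
  by rewrite !subrK enorm_sym; lra.
have : (enorm u)^-1 <= r^-1 by rewrite lef_pV2.
move=> /(ler_wpM2r (enorm_ge0 (u - v))).
have := ler_wpM2l (ltW (_ : 0 < (enorm u)^-1)) uv.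
by rewrite invr_gt0 => /(_ u0); lra.
Qed.

Lemma pull_lipschitz x x' h h' D r : 0 <= D -> 0 < r -> r <= enorm (x - h) ->
  0 < enorm (x' - h') ->
  enorm (pull h D x - pull h' D x') <=
    enorm (x - x') + D * (2 / r) * enorm ((h - x) - (h' - x')).
Proof.
move=> D0 r0 rh h'0; rewrite /pull.
have -> : x + D / enorm (h - x) *: (h - x) - (x' + D / enorm (h' - x') *: (h' - x')) =
  (x - x') + D *: ((enorm (h - x))^-1 *: (h - x) - (enorm (h' - x'))^-1 *: (h' - x')).
  by apply/rowP => i; rewrite !mxE; ring.
apply: le_trans (ler_enormD _ _) _; rewrite lerD2l.
rewrite enormZ (ger0_norm D0) -mulrA; apply: ler_wpM2l => //.
by apply: normalize_lipschitz => //; rewrite enorm_sym.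
Qed.

Lemma pull_lipschitz_center x h h' D r : 0 <= D -> 0 < r -> r <= enorm (x - h) ->
  0 < enorm (x - h') ->
  enorm (pull h D x - pull h' D x) <= D * (2 / r) * enorm (h - h').
Proof.
move=> D0 r0 rh h'0; have := pull_lipschitz x x h h' D r D0 r0 rh h'0.
by rewrite subrr enorm0 add0r opprB subrKA.
Qed.

(** If almost nearest points with image outside [U] existed for every [e], compactness would give a
    nearest point with image outside [U]. The set [K] of bad centers is closed because [pull] is
    Lipschitz in its center away from [x]. *)
Lemma pull_nearest_open (U : set V) x D r : open U -> 0 <= D -> 0 < r ->
  r <= dist_pt x H -> (forall h, nearest x h -> U (pull h D x)) ->
  exists2 e : R, 0 < e &
    forall h, H h -> enorm (x - h) < dist_pt x H + e -> U (pull h D x).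
Proof.
move=> /open_enormP oU D0 r0 rx xU; apply: contrapT => noe.
pose K := [set h | [/\ closure H h, enorm (x - h) <= dist_pt x H + 1 &
  ~ U (pull h D x)]].
have Hr h : closure H h -> r <= enorm (x - h).
  by move=> /(dist_pt_le_closure H x); exact: le_trans.
have cK : compact K.
  apply: (@enorm_compact _ _ _ (enorm x + dist_pt x H + 1)); last first.
    move=> h [_ hx _]; have := ler_enormD x (h - x).
    by rewrite addrC subrK enorm_sym; lra.
  move=> h /closure_enormP hK.
  have Hh : closure H h.
    apply/closure_enormP => e e0; have e20 : 0 < e / 2 by rewrite divr_gt0.
    have [h' [/closure_enormP/(_ _ e20)[y Hy h'y] _ _] hh'] := hK _ e20.
    by exists y => //; have := ler_edist_add h' h y; lra.
  split=> // [|Uh].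
    apply/ler_addgt0Pr => e /hK[h' [_ xh' _] hh'].
    by have := ler_edist_add h' x h; rewrite (enorm_sym h' h); lra.
  have [e e0 eU] := oU _ Uh.
  have C0 : 0 <= D * (2 / r) by rewrite mulr_ge0// divr_ge0// ltW.
  have [h' [Hh' _ nUh'] hh'] :=
    hK (e / (D * (2 / r) + 1)) (divr_gt0 e0 (ltr_wpDl C0 ltr01)).
  apply: nUh'; apply: eU; rewrite enorm_sym.
  apply: le_lt_trans (pull_lipschitz_center _ _ _ _ _ D0 r0 (Hr _ Hh) _) _.
    exact: lt_le_trans (Hr _ Hh').
  move: hh'; rewrite ltr_pdivlMr ?ltr_wpDl// => hh'.
  by have := enorm_ge0 (h - h'); lra.
have cf : continuous (fun h => enorm (x - h) - dist_pt x H).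
  apply: (@lipschitz_continuous _ _ _ 1) => y z; rewrite mul1r ler_norml.
  have := ler_edist_add z x y; have := ler_edist_add y x z.
  by rewrite (enorm_sym z y); lra.
have [e e0|h [Hh xh nUh] xh0] := compact_exists_le0 _ _ cK cf.
  apply: contrapT => noK; apply: noe; exists (Num.min e 1).
    by rewrite lt_min e0 ltr01.
  move=> h Hh xh; apply: contrapT => nU; apply: noK; exists h.
    split=> //; first exact: subset_closure.
    by apply: (le_trans (ltW xh)); rewrite lerD2l ge_min lexx orbT.
  by rewrite lerBlDl (le_trans (ltW xh))// lerD2l ge_min lexx.
apply: nUh; apply: xU; split=> //; apply/eqP; rewrite eq_le -subr_le0 xh0/=.
exact: dist_pt_le_closure.
Qed.

Lemma rat_row_dense x (e : R) : 0 < e ->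
  exists q : 'rV[rat]_d.+1, enorm (x - map_mx ratr q) < e.
Proof.
move=> e0; set dl := e / d.+2%:R; have dl0 : 0 < dl by rewrite divr_gt0.
have /choice[q qx] : forall i, exists q : rat, x ord0 i < ratr q < x ord0 i + dl.
  move=> i; have [|p px] := @rat_in_itvoo R (x ord0 i) (x ord0 i + dl).
    by rewrite ltrDl.
  by exists p; move: px; rewrite in_itv.
exists (\row_i q i); apply: (@le_lt_trans _ _ (d.+1%:R * dl)).
  apply: enorm_le_coord => [i|]; last exact: ltW.
  by have := qx i; rewrite !mxE ler_norml; lra.
by rewrite /dl mulrCA gtr_pMr// ltr_pdivrMr// mul1r ltr_nat.
Qed.

(** Whenever a ball with rational center and radius $1/(n+1)$ meets [H], one point of [H] in it is
    chosen. *)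
Lemma exists_dense_seq : exists s : nat -> V, (forall k, H (s k)) /\
  forall h, H h -> forall e : R, 0 < e -> exists k, enorm (h - s k) < e.
Proof.
have [h0 Hh0] := H0.
pose P (q : 'rV[rat]_d.+1) (n : nat) y := H y /\ enorm (y - map_mx ratr q) < n.+1%:R^-1.
have /choice[s sP] : forall k : nat, exists y, H y /\
    (forall q n, unpickle k = Some (q, n) -> (exists z, P q n z) -> P q n y).
  move=> k; case E : (unpickle k : option ('rV[rat]_d.+1 * nat)) => [[q n]|];
    last by exists h0.
  have [[z zP]|noz] := pselect (exists z, P q n z).
    by exists z; split; [case: zP|move=> q' n' [<- <-] _].
  by exists h0; split=> // q' n' [<- <-].
exists s; split=> [k|h Hh e e0]; first by case: (sP k).
have e20 : 0 < e / 2 by rewrite divr_gt0.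
have [n _ ne] := @near_infty_natSinv_lt R (PosNum e20).
have n0 : 0 < n.+1%:R^-1 :> R by rewrite invr_gt0.
have [q qh] := rat_row_dense h _ n0.
have [k kqn] : exists k, unpickle k = Some (q, n).
  by exists (pickle (q, n)); exact: pickleK.
exists k; have [_ /(_ q n kqn)[|_ sq]] := sP k; first by exists h.
have ne' : n.+1%:R^-1 < e / 2 := ne n (leqnn n).
apply: le_lt_trans (ler_edist_add (map_mx ratr q) h (s k)) _.
rewrite (splitr e) (enorm_sym (map_mx ratr q)).
by apply: ltrD; [exact: lt_trans qh ne'|exact: lt_trans sq ne'].
Qed.

Section Voronoi.
Variable s : nat -> V.

(** Cells of the centers [s 0], ..., [s m]. A tie goes to the smallest index, so the cells partition
    the space. *)
Definition voronoi (m i : nat) : set V :=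
  [set x | (forall j : 'I_m.+1, enorm (x - s i) <= enorm (x - s j)) /\
           (forall j : 'I_i, enorm (x - s i) < enorm (x - s j))].

Lemma leb_measurable_voronoi m i : leb_measurable (voronoi m i).
Proof.
have cf j : continuous (fun x => enorm (x - s i) - enorm (x - s j)).
  apply: (@lipschitz_continuous _ _ _ 2) => y z; rewrite ler_norml.
  have := ler_edist_add z y (s i); have := ler_edist_add y z (s i).
  have := ler_edist_add z y (s j); have := ler_edist_add y z (s j).
  by rewrite (enorm_sym z y); lra.
pose F (j : nat) := [set x | enorm (x - s i) - enorm (x - s j) <= 0].
pose G (j : nat) := [set x | enorm (x - s i) - enorm (x - s j) < 0].
rewrite (_ : voronoi m i = [set x | forall j : 'I_m.+1, F j x] `&`
    [set x | forall j : 'I_i, G j x]).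
  apply: leb_measurableI.
    apply: leb_measurable_fin_bigcap => j.
    by apply: leb_measurable_closed; exact: continuous_closed_le.
  apply: leb_measurable_fin_bigcap => j.
  by apply: leb_measurable_open; exact: continuous_open_lt.
apply/seteqP; split=> x [xm xi]; split=> j; have := xm; have := xi; rewrite /F/G/=.
- by move=> _ /(_ j); rewrite subr_le0.
- by move=> /(_ j); rewrite subr_lt0.
- by move=> _ /(_ j); rewrite subr_le0.
- by move=> /(_ j); rewrite subr_lt0.
Qed.

Lemma voronoi_inj m i j x : (i <= m)%N -> (j <= m)%N ->
  voronoi m i x -> voronoi m j x -> i = j.
Proof.
wlog ij : i j / (i < j)%N => [hw im jm xi xj|im jm [xi _] [_ xj]].
  have [ij|ji|//] := ltngtP i j; first exact: hw ij im jm xi xj.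
  by apply/esym; exact: hw ji jm im xj xi.
have jm1 : (j < m.+1)%N by [].
have := xi (Ordinal jm1); have := xj (Ordinal ij).
by rewrite /= ltNge => /negP.
Qed.

Lemma voronoi_cover m x : exists2 i, (i <= m)%N & voronoi m i x.
Proof.
pose f (i : nat) := enorm (x - s i).
have [i0 _ i0P] := @arg_minP _ _ _ (ord0 : 'I_m.+1) xpredT (fun i => f i) isT.
pose P (i : nat) := (i <= m)%N && [forall j : 'I_m.+1, f i <= f j].
have exP : exists i, P i.
  by exists i0; rewrite /P -ltnS ltn_ord/=; apply/forallP => j; exact: i0P.
case: (ex_minnP exP) => i /andP[im /forallP iP] imin.
exists i => //; split=> j; first exact: iP.
rewrite ltNge; apply/negP => ji; have : P j.
  apply/andP; split; first exact: leq_trans (ltnW (ltn_ord j)) im.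
  by apply/forallP => k; apply: le_trans ji (iP k).
by move=> /imin; rewrite leqNgt ltn_ord.
Qed.

(* Voronoi cells are star-shaped about their centers. *)
Lemma voronoi_pull m i D x : 0 <= D -> D < enorm (x - s i) ->
  voronoi m i x -> voronoi m i (pull (s i) D x).
Proof.
move=> D0 Dx [xm xi]; have x0 : 0 < enorm (x - s i) by exact: le_lt_trans Dx.
have far j : enorm (x - s j) - D <= enorm (pull (s i) D x - s j).
  have := ler_edist_add (pull (s i) D x) x (s j).
  by rewrite (enorm_sym x (pull _ _ _)) enorm_pull_sub//; lra.
have near : enorm (pull (s i) D x - s i) = enorm (x - s i) - D.
  by apply: enorm_pull => //; exact: ltW.
by split=> j; rewrite near; have := far j; [have := xm j|have := xi j]; lra.
Qed.

(** On each cell [push] undoes the pull, at distance at least [r - D] from the center. The image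
    stays in its cell, so the parts of [U] used by different cells are disjoint. *)
Lemma leb_outer_voronoi_pull (A U : set V) m D r : 0 <= D -> D < r ->
  (forall x, A x -> forall i, (i <= m)%N -> r <= enorm (x - s i)) ->
  (forall x i, A x -> (i <= m)%N -> voronoi m i x -> U (pull (s i) D x)) ->
  (mu A <= ((1 + D / (r - D)) ^+ d)%:E * mu U)%E.
Proof.
move=> D0 Dr Ar AU; have rD0 : 0 < r - D by rewrite subr_gt0.
set L := (_ ^+ d)%:E; have L0 : (0 <= L)%E.
  by rewrite lee_fin exprn_ge0// addr_ge0// divr_ge0// ltW.
pose F i := if (i <= m)%N then voronoi m i else set0.
have mF i : leb_measurable (F i).
  rewrite /F; case: ifP => _; [exact: leb_measurable_voronoi|exact: leb_measurable0].
have tF : trivIset setT F.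
  apply/trivIsetP => i j _ _ ij; apply/seteqP; split=> // x [].
  rewrite /F; case: ifP => // im xi; case: ifP => // jm xj.
  by move/eqP: ij; apply; exact: voronoi_inj im jm xi xj.
apply: (@le_trans _ _ (\sum_(i <- iota 0 m.+1) mu (A `&` F i))%E).
  apply: le_trans (leb_outer_fin_subadditive _ _ _); apply: le_leb_outer => x Ax.
  have [i im xi] := voronoi_cover m x.
  by exists i; [rewrite mem_iota|split=> //; rewrite /F im].
apply: (@le_trans _ _ (\sum_(i <- iota 0 m.+1) L * mu (U `&` F i))%E).
  rewrite big_seq [leRHS]big_seq; apply: lee_sum => i.
  rewrite mem_iota add0n ltnS /= => im; rewrite /F im.
  apply: (@le_trans _ _ (L * mu (pull (s i) D @` (A `&` voronoi m i)))%E).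
    apply: le_trans (leb_outer_push (s i) D (r - D) _ D0 rD0 _).
      apply: le_leb_outer => x [Ax xi]; exists (pull (s i) D x); first by exists x.
      by apply: pullK => //; apply: lt_le_trans (Ar _ Ax _ im).
    move=> _ [x [Ax xi] <-]; have xr := Ar _ Ax _ im.
    rewrite enorm_pull ?lerD2r//; last exact: lt_le_trans (le_lt_trans D0 Dr) xr.
    exact: le_trans (ltW Dr) xr.
  apply: lee_wpmul2l => //; apply: le_leb_outer => _ [x [Ax xi] <-]; split.
    exact: AU.
  by apply: voronoi_pull => //; exact: lt_le_trans (Ar _ Ax _ im).
rewrite -ge0_sume_distrr; last by move=> i _; exact: leb_outer_ge0.
apply: lee_wpmul2l => //.
(* Additivity over disjoint measurable cells holds for the trace of any set, here [U]. *)
have add : forall n X, mu (X `&` \big[setU/set0]_(i < n) F i) =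
    (\sum_(i < n) mu (X `&` F i))%E := caratheodory_additive mF tF.
rewrite -[iota 0 m.+1]/(index_iota 0 m.+1) big_mkord -add.
by apply: le_leb_outer => x [].
Qed.

End Voronoi.

Lemma leb_outer_pulls A D r : 0 <= D -> D < r ->
  (forall x, A x -> r <= dist_pt x H) ->
  (mu A <= ((1 + D / (r - D)) ^+ d)%:E * mu (pulls D A))%E.
Proof.
move=> D0 Dr Ar; have [s [Hs ds]] := exists_dense_seq.
have r0 : 0 < r by exact: le_lt_trans Dr.
set L := _ ^+ d; have L0 : 0 < L.
  by rewrite exprn_gt0// ltr_wpDr// divr_ge0// subr_ge0 ltW.
suff H1 (U : set V) : open U -> pulls D A `<=` U -> (mu A <= L%:E * mu U)%E.
  apply/lee_addgt0Pr => e e0.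
  have [U [oU AU Ue]] := leb_outer_open (pulls D A) (e / L) (divr_gt0 e0 L0).
  apply: le_trans (H1 _ oU AU) _; apply: le_trans (lee_wpmul2l _ Ue) _.
    by rewrite lee_fin ltW.
  rewrite ge0_muleDr ?leb_outer_ge0 ?lee_fin ?(ltW (divr_gt0 e0 L0))//.
  by rewrite -EFinM [L * (e / L)]mulrC divfK// gt_eqF.
move=> oU AU.
(* Points that every approximation from stage [k] on sends into [U]. These sets increase with [k]
   and are not known to be measurable. *)
pose B k := [set x | A x /\ forall m i, (k <= m)%N -> (i <= m)%N ->
  voronoi s m i x -> U (pull (s i) D x)].
have sr x i : A x -> r <= enorm (x - s i).
  by move=> /Ar; move/le_trans; apply; exact: dist_pt_le.
apply: (@le_trans _ _ (mu (\bigcup_k B k))).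
  apply: le_leb_outer => x Ax.
  have [|e e0 eU] := pull_nearest_open U x D r oU D0 r0 (Ar _ Ax).
    by move=> h xh; apply: AU; exists x, h.
  have e20 : 0 < e / 2 by rewrite divr_gt0.
  have [h Hh xh] := dist_pt_approx H H0 x _ e20.
  have [k hk] := ds _ Hh _ e20.
  exists k => //; split=> // m i km im [xm _]; apply: eU => //.
  (* From stage [k] on the chosen center is no farther from [x] than [s k], hence almost nearest. *)
  have km1 : (k < m.+1)%N by [].
  have := xm (Ordinal km1); rewrite /=.
  by have := ler_edist_add h x (s k); lra.
apply: leb_outer_nondecreasing => [k m km x [Ax xk]|k].
  by split=> // n i mn; apply: xk; exact: leq_trans mn.
apply: (leb_outer_voronoi_pull s (B k) U k D r) => //.
  by move=> x [Ax _] i _; exact: sr.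
by move=> x i [Ax xk]; exact: xk.
Qed.

End PullInequality.

(** * Lipschitz images *)

Section LipschitzImage.
Context {R : realType} {d : nat}.
Local Notation V := 'rV[R]_d.+1.
Local Notation mu := (@leb_outer R d.+1).
Implicit Types (X E : set V) (f : V -> V) (C M : R).

Definition lipschitz_on X C f :=
  forall x y, X x -> X y -> enorm (f x - f y) <= C * enorm (x - y).

(** The image of a cube lies in a cube larger by a fixed factor; [C + 1] replaces [C] to keep that
    factor positive. *)
Lemma leb_null_lipschitz X C f : 0 <= C -> lipschitz_on X C f ->
  mu X = 0%E -> mu (f @` X) = 0%E.
Proof.
move=> C0 fC X0; have C10 : 0 < C + 1 by rewrite ltr_wpDl.
have : (mu (f @` X) <= ((2 * ((C + 1) * d.+1%:R)) ^+ d.+1)%:E * mu X)%E.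
  apply: (leb_outer_image_le X f _ 1) => [|//|a dl dl0 _].
    by rewrite exprn_gt0// !mulr_gt0.
  have [[y [Xy ya]]|Xa0] := pselect ((X `&` box a (a + const_mx dl)) !=set0); last first.
    rewrite (_ : X `&` _ = set0) ?image_set0 ?leb_outer0 ?lee_fin.
      by rewrite mulr_ge0 ?exprn_ge0 ?mulr_ge0 ?(ltW C10) ?(ltW dl0).
    by apply/seteqP; split=> // x Xx; apply: Xa0; exists x.
  rewrite -exprMn; set s := 2 * _ * dl.
  have s0 : 0 <= s by rewrite !mulr_ge0// ltW.
  apply: le_trans (leb_outer_cube (f y - const_mx (s / 2)) _ s0).
  apply: le_leb_outer => _ [x [Xx xa] <-] i; rewrite !mxE.
  have xy : enorm (x - y) <= d.+1%:R * dl.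
    apply: enorm_le_coord => [j|]; last exact: ltW.
    by have := xa j; have := ya j; rewrite !mxE ler_norml; lra.
  have : `|(f x - f y) ord0 i| <= s / 2.
    apply: le_trans (coord_le_enorm _ _) _; apply: le_trans (fC _ _ Xx Xy) _.
    rewrite (_ : s / 2 = (C + 1) * (d.+1%:R * dl)); last by rewrite /s; field.
    by apply: ler_pM => //; [exact: enorm_ge0|rewrite lerDl].
  by rewrite !mxE ler_norml; lra.
by rewrite X0 mule0 => fX0; apply/eqP; rewrite eq_le fX0 leb_outer_ge0.
Qed.

Lemma leb_outer_bounded X M : (forall x, X x -> enorm x <= M) -> 0 <= M ->
  (mu X <= ((2 * M) ^+ d.+1)%:E)%E.
Proof.
move=> XM M0; have M20 : 0 <= 2 * M by rewrite mulr_ge0.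
apply: le_trans (leb_outer_cube (const_mx (- M)) _ M20).
apply: le_leb_outer => x /XM xM i; rewrite !mxE.
by have := le_trans (coord_le_enorm x i) xM; rewrite ler_norml; lra.
Qed.

(** From a closed ball containing [X], an open set slightly larger than the complement of [X] in
    that ball is removed; the loss is measured by splitting this open set along [X]. *)
Lemma leb_measurable_inner_compact X M (e : R) : leb_measurable X ->
  (forall x, X x -> enorm x <= M) -> 0 <= M -> 0 < e ->
  exists K : set V, [/\ compact K, K `<=` X & (mu (X `\` K) <= e%:E)%E].
Proof.
move=> mX XM M0 e0; pose B := [set x : V | enorm x <= M].
have cB : closed B by apply: continuous_closed_le; exact: enorm_continuous.
have [U [oU BU Ue]] := leb_outer_open (B `\` X) e e0.
exists (B `&` ~` U); split.
- apply: (@enorm_compact _ _ _ M) => [|x []//].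
  by apply: closedI => //; exact: open_closedC.
- by move=> x [Bx Ux]; apply: contrapT => Xx; apply: Ux; apply: BU.
have Bfin : mu (B `\` X) \is a fin_num.
  rewrite ge0_fin_numE ?leb_outer_ge0//.
  by apply: le_lt_trans (leb_outer_bounded _ M _ M0) (ltry _) => x [].
have -> : X `\` (B `&` ~` U) = U `&` X.
  apply/seteqP; split=> x.
    case=> Xx nBU; split=> //; apply: contrapT => Ux; apply: nBU.
    by split=> //; exact: XM.
  by case=> Ux Xx; split=> // -[_]; exact.
move: Ue; rewrite (mX U) addeC => /(le_trans _) Ue.
have : (mu (B `\` X) + mu (U `&` X) <= mu (B `\` X) + e%:E)%E.
  apply: Ue; rewrite leeD2r//; apply: le_leb_outer => x [Bx Xx].
  by split=> //; exact: BU.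
by rewrite leeD2lE.
Qed.

(** Up to a null set, [X] is a countable union of compact sets; their images are compact, and the
    null set has null image. *)
Lemma leb_measurable_lipschitz_image X M C f : leb_measurable X ->
  (forall x, X x -> enorm x <= M) -> 0 <= M -> 0 <= C -> lipschitz_on X C f ->
  leb_measurable (f @` X).
Proof.
move=> mX XM M0 C0 fC.
have /choice[K KP] : forall k, exists K : set V,
    [/\ compact K, K `<=` X & (mu (X `\` K) <= (k.+1%:R^-1)%:E)%E].
  by move=> k; apply: (leb_measurable_inner_compact X M _ mX XM M0); rewrite invr_gt0.
pose N := X `\` \bigcup_k K k.
have N0 : mu N = 0%E.
  apply/eqP; rewrite eq_le leb_outer_ge0 andbT; apply/lee_addgt0Pr => e e0.
  have [k _ ke] := @near_infty_natSinv_lt R (PosNum e0).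
  have [_ _ Kk] := KP k; rewrite add0e; apply: (@le_trans _ _ (mu (X `\` K k))).
    by apply: le_leb_outer => x [Xx nK]; split=> // Kx; apply: nK; exists k.
  by apply: le_trans Kk _; rewrite lee_fin ltW//; exact: (ke k (leqnn k)).
have -> : f @` X = \bigcup_k (f @` K k) `|` f @` N.
  rewrite -image_bigcup -image_setU; congr (f @` _); apply/seteqP; split=> x.
    by move=> Xx; have [?|?] := pselect ((\bigcup_k K k) x); [left|right].
  by case=> [[k _ Kx]|[//]]; case: (KP k) => _ + _; apply.
apply: leb_measurableU; last first.
  apply/leb_null_measurable/(leb_null_lipschitz N C) => // x y [Xx _] [Xy _].
  exact: fC.
apply: leb_measurable_bigcup => k; have [cK KX _] := KP k.
apply: leb_measurable_closed; apply: compact_closed.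
  exact: (@norm_hausdorff R V).
apply: continuous_compact cK; apply: (@lipschitz_continuous_within _ _ _ _ _ C).
by move=> x y Kx Ky; apply: fC; exact: KX.
Qed.

Lemma leb_null_bounded X :
  (forall k : nat, mu (X `&` [set x | enorm x <= k%:R]) = 0%E) -> mu X = 0%E.
Proof.
move=> X0; apply: leb_null_sub (leb_null_bigcup _ X0) => x Xx.
exists (Num.truncn (enorm x)).+1 => //; split=> //=.
by have /truncn_itv/andP[_ /ltW] := enorm_ge0 x.
Qed.

End LipschitzImage.

(** * Prolongation of shortest segments *)

Section RayExtension.
Context {R : realType} {d : nat}.
Local Notation V := 'rV[R]_d.+1.
Local Notation mu := (@leb_outer R d.+1).
Variable H : set V.
Hypothesis H0 : H !=set0.
Implicit Types (Y : set V) (x y z h : V) (s t r M : R).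
Local Notation dist x := (dist_pt x H).

(* The points at which the segment to a nearest point of [H] prolongs backwards
   by the length [s] to a shortest segment. *)
Definition ext s : set V :=
  [set y | exists x, enorm (x - y) <= s /\ dist y + s <= dist x].

(** Points whose maximal prolongation is exactly [s]. As [ext 0] is the whole space, [ray_end 0]
    collects the points with no prolongation at all. *)
Definition ray_end s : set V := ext s `\` \bigcup_n ext (s + n.+1%:R^-1).

Lemma le_ext s t : 0 <= s -> s <= t -> ext t `<=` ext s.
Proof.
move=> s0 st y [x [xy yx]]; have [t0|t0] := ltP 0 t; last first.
  have st' : s = t by lra.
  by exists x; rewrite st'.
have st1 : s / t <= 1 by rewrite ler_pdivrMr// mul1r.
have st0 : 0 <= s / t by rewrite divr_ge0// ltW.
exists (y + (s / t) *: (x - y)); split.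
  rewrite addrC addKr enormZ ger0_norm//.
  by have := ler_wpM2l st0 xy; rewrite divfK// gt_eqF.
have := dist_pt_lipschitz H H0 x (y + (s / t) *: (x - y)).
rewrite (_ : x - (y + _) = (1 - s / t) *: (x - y)); last first.
  by apply/rowP => i; rewrite !mxE; ring.
have st10 : 0 <= 1 - s / t by rewrite subr_ge0.
rewrite enormZ ger0_norm// => xd.
have := ler_wpM2l st10 xy.
have -> : (1 - s / t) * t = t - s by field; rewrite gt_eqF.
by move: xd yx; move: ((1 - s / t) * _) => q; lra.
Qed.

(** Relaxing both inequalities by [q] to strict ones gives an open set, since a fixed [x] serves for
    all nearby [y]. Compactness recovers the exact condition from all the relaxed ones. *)
Lemma leb_measurable_ext s : leb_measurable (ext s).
Proof.
pose U (q : R) : set V := [set y | exists x, enorm (x - y) < s + q /\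
  dist y + s - q < dist x].
have -> : ext s = \bigcap_n U n.+1%:R^-1.
  apply/seteqP; split=> [y [x [xy yx]] n _|y yU].
    have : 0 < n.+1%:R^-1 :> R by rewrite invr_gt0.
    by move: n.+1%:R^-1 => q q0; exists x; split; lra.
  (* The larger violation of the two conditions; [x] is a witness as soon as it is at most 0. *)
  pose f x := Num.max (enorm (y - x) - s) (dist y + s - dist x).
  have cf : continuous f.
    apply: (@lipschitz_continuous _ _ _ 1) => x z; rewrite mul1r /f.
    have := ler_edist_add x y z; have := ler_edist_add z y x.
    have := dist_pt_lipschitz H H0 x z; have := dist_pt_lipschitz H H0 z x.
    rewrite (enorm_sym z x) ler_norml /Num.max; do 2 case: ifPn; rewrite -?leNgt; lra.
  have cK : compact [set x | enorm (y - x) <= s + 1].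
    apply: (@enorm_compact _ _ _ (enorm y + s + 1)) => [|x /= yx].
      by apply: continuous_closed_le; exact: edist_continuous.
    by have := ler_enormD y (x - y); rewrite addrC subrK enorm_sym; lra.
  have [e e0|x _] := compact_exists_le0 _ _ cK cf.
    have [n _ ne] := @near_infty_natSinv_lt R (PosNum e0).
    have := ne n (leqnn n); have := yU n Logic.I.
    have : n.+1%:R^-1 <= 1 :> R by rewrite invf_le1// ler1n.
    rewrite /=; move: n.+1%:R^-1 => q q1 [x [xy yx]] qe.
    exists x => /=; first by rewrite enorm_sym; lra.
    by rewrite /f enorm_sym ge_max; apply/andP; split; lra.
  by rewrite ge_max => /andP[xy yx]; exists x; split; rewrite ?(enorm_sym x y); lra.
apply: leb_measurable_bigcap => n; apply: leb_measurable_open.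
move: n.+1%:R^-1 => q; apply/open_enormP => y [x [xy yx]].
pose e := Num.min (s + q - enorm (x - y)) (dist x - (dist y + s - q)).
exists e => [|z]; first by rewrite lt_min; apply/andP; split; lra.
rewrite lt_min => /andP[z1 z2]; exists x.
have := ler_edist_add y x z; have := dist_pt_lipschitz H H0 z y.
by rewrite (enorm_sym y z); split; lra.
Qed.

Lemma leb_measurable_ray_end s : leb_measurable (ray_end s).
Proof.
apply: leb_measurableD; first exact: leb_measurable_ext.
by apply: leb_measurable_bigcup => n; exact: leb_measurable_ext.
Qed.

Lemma ray_end_disjoint s t x : 0 <= s -> 0 <= t ->
  ray_end s x -> ray_end t x -> s = t.
Proof.
wlog st : s t / s < t => [hw s0 t0 xs xt|s0 t0 [_ xs] [xt _]].
  by have [st|ts|//] := ltgtP s t; [exact: hw|apply/esym; exact: hw].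
exfalso; apply: xs; have ts0 : 0 < t - s by rewrite subr_gt0.
have [n _ ne] := @near_infty_natSinv_lt R (PosNum ts0).
have ne' : n.+1%:R^-1 < t - s := ne n (leqnn n).
have n0 : 0 < n.+1%:R^-1 :> R by rewrite invr_gt0.
exists n => //; apply: le_ext xt; move: ne' n0; move: n.+1%:R^-1 => q; lra.
Qed.

Lemma pull_nearest y h t : nearest H y h -> 0 < dist y -> 0 <= t -> t <= dist y ->
  [/\ dist (pull h t y) = dist y - t, enorm (pull h t y - h) = dist y - t &
      enorm (pull h t y - y) = t].
Proof.
move=> [Hh yh] y0 t0 ty.
have e1 : enorm (pull h t y - h) = dist y - t by rewrite enorm_pull ?yh.
have e2 : enorm (pull h t y - y) = t by rewrite enorm_pull_sub ?yh.
split=> //; apply/eqP; rewrite eq_le -{1}e1 dist_pt_le_closure//= lerBlDr.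
by have := dist_pt_lipschitz H H0 y (pull h t y); rewrite enorm_sym e2.
Qed.

(** The path from [x] through [z] to [h] is no longer than the distance from [x] to [H], so the
    equality case of the triangle inequality makes the three points collinear. *)
Lemma ext_ray z h s x : closure H h -> enorm (z - h) = dist z -> 0 <= s ->
  enorm (x - z) <= s -> dist z + s <= dist x ->
  dist z *: (x - z) = s *: (z - h).
Proof.
move=> Hh zh s0 xz zx; apply: enormD_eq => //.
- exact: dist_pt_ge0.
- by rewrite zh.
by rewrite subrKA [leLHS]addrC; apply: le_trans zx (dist_pt_le_closure _ _ _ Hh).
Qed.

Lemma pull_ext y h s t : nearest H y h -> 0 < dist y -> 0 <= t -> t <= dist y ->
  ext s y -> ext (s + t) (pull h t y).
Proof.
move=> yh y0 t0 ty [x [xy yx]]; have [zd _ zy] := pull_nearest y h t yh y0 t0 ty.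
exists x; split; last by rewrite zd; lra.
by have := ler_edist_add y x (pull h t y); rewrite (enorm_sym y) zy; lra.
Qed.

(** A prolongation of the pulled point follows the ray from [h] and so passes through [y]. The
    strict bound [t < dist y] keeps the pulled point off [h], which fixes that direction. *)
Lemma pull_ext_inv y h s t : nearest H y h -> 0 < dist y -> 0 <= s -> 0 <= t ->
  t < dist y -> ext (s + t) (pull h t y) -> ext s y.
Proof.
move=> yh y0 s0 t0 ty [x [xz zx]].
have [zd zh zy] := pull_nearest y h t yh y0 t0 (ltW ty).
have [Hh yhd] := yh; set z := pull h t y in zd zh zy xz zx *.
have zdh : enorm (z - h) = dist z by rewrite zh zd.
have ray := ext_ray z h _ x Hh zdh (addr_ge0 s0 t0) xz zx.
exists x; split; last by move: zx; rewrite zd; lra.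
have dt0 : 0 < dist y - t by rewrite subr_gt0.
have zE : z - h = (1 - t / dist y) *: (y - h) by rewrite /z pull_sub yhd.
have zyE : z - y = - (t / dist y) *: (y - h).
  by rewrite /z /pull addrAC subrr add0r enorm_sym yhd -opprB scalerN scaleNr.
have xzE : x - z = ((s + t) / dist y) *: (y - h).
  move: ray; rewrite zd zE scalerA => /(congr1 (fun v => (dist y - t)^-1 *: v)).
  rewrite !scalerA mulVf ?scale1r ?gt_eqF// => ->; congr (_ *: _).
  by field; rewrite !gt_eqF.
have -> : x - y = (s / dist y) *: (y - h).
  rewrite -(subrKA z) xzE zyE -scalerDl; congr (_ *: _).
  by field; rewrite gt_eqF.
by rewrite enormZ yhd ger0_norm ?divr_ge0 ?(ltW y0)// divfK// gt_eqF.
Qed.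

(** Pulling by [t] lengthens the maximal prolongation by exactly [t]. *)
Lemma pulls_ray_end Y s t : 0 <= s -> 0 <= t -> Y `<=` ray_end s ->
  (forall y, Y y -> t < dist y) -> pulls H t Y `<=` ray_end (s + t).
Proof.
move=> s0 t0 Ys Yt _ [y [h [Yy yh ->]]]; have ty := Yt _ Yy.
have y0 : 0 < dist y by exact: le_lt_trans ty.
have [ys ynot] := Ys _ Yy; split; first by apply: pull_ext => //; exact: ltW.
move=> [n _ zn]; apply: ynot; exists n => //.
apply: (pull_ext_inv y h _ t) => //; first by rewrite addr_ge0// invr_ge0.
by rewrite addrAC.
Qed.

(* The sets [pulls H t Y] are disjoint, lie in a bounded region, and each has at
   least a fixed fraction of the measure of [Y]. *)
Lemma leb_null_pulls Y M r (F : R -> set V) : 0 < r ->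
  (forall y, Y y -> enorm y <= M) -> (forall y, Y y -> r <= dist y) -> 0 <= M ->
  (forall t, leb_measurable (F t)) ->
  (forall t t' x, 0 <= t -> t < r -> 0 <= t' -> t' < r -> F t x -> F t' x -> t = t') ->
  (forall t, 0 <= t -> t < r -> pulls H t Y `<=` F t) ->
  mu Y = 0%E.
Proof.
move=> r0 YM Yr M0 mF dF YF.
(* Infinitely many distinct lengths, all at most [r / 2], so that the factor in [leb_outer_pulls]
   never exceeds [2 ^+ d]. *)
pose t (i : nat) := r / i.+2%:R.
have t0 i : 0 <= t i by rewrite divr_ge0// ltW.
have tr2 i : t i <= r / 2 by rewrite ler_pM2l// lef_pV2 ?posrE// ler_nat.
have tr i : t i < r by have := tr2 i; lra.
pose B := [set x : V | enorm x <= M + r].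
have Bfin := leb_outer_bounded B (M + r) (fun x xB => xB) (addr_ge0 M0 (ltW r0)).
set b := _ ^+ _ in Bfin.
have tF : trivIset setT (F \o t).
  apply/trivIsetP => i j _ _ ij; apply/seteqP; split=> // x [xi xj].
  have := dF _ _ _ (t0 i) (tr i) (t0 j) (tr j) xi xj.
  move=> /(mulfI (lt0r_neq0 r0))/invr_inj/eqP.
  by rewrite eqr_nat !eqSS (negbTE ij).
have sumF n : (\sum_(i < n) mu (B `&` F (t i)) <= b%:E)%E.
  have add : forall n X, mu (X `&` \big[setU/set0]_(i < n) (F \o t) i) =
    (\sum_(i < n) mu (X `&` (F \o t) i))%E :=
    caratheodory_additive (fun i => mF (t i)) tF.
  by rewrite -[X in (X <= _)%E]add; apply: le_trans Bfin; apply: le_leb_outer => x [].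
have YF2 i : (mu Y <= (2 ^+ d)%:E * mu (B `&` F (t i)))%E.
  apply: le_trans (leb_outer_pulls H H0 Y (t i) r (t0 i) (tr i) Yr) _.
  apply: lee_pmul; rewrite ?leb_outer_ge0 ?lee_fin//.
  - by rewrite exprn_ge0// addr_ge0// divr_ge0// subr_ge0 ltW.
  - have rt0 : 0 < r - t i by rewrite subr_gt0.
    have q2 : t i / (r - t i) <= 1 by rewrite ler_pdivrMr//; have := tr2 i; lra.
    have q0 : 0 <= t i / (r - t i) by rewrite divr_ge0// ltW.
    by rewrite lerXn2r ?nnegrE//; lra.
  apply: le_leb_outer => z zY; split; last by apply: YF.
  move: zY => [y [h [Yy yh ->]]]; rewrite /B/=.
  have yr := Yr _ Yy; have := YM _ Yy; have ti := tr i.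
  have [||_ _ zy] := pull_nearest y h (t i) yh _ (t0 i); [lra|lra|].
  by have := ler_enormD (pull h (t i) y - y) y; rewrite subrK zy; lra.
(* Every multiple of the measure of [Y] stays below one constant, which forces the measure to be
   0. *)
have Y2n n : (n%:R%:E * mu Y <= (2 ^+ d * b)%:E)%E.
  apply: (@le_trans _ _ (\sum_(i < n) (2 ^+ d)%:E * mu (B `&` F (t i)))%E).
    apply: (@le_trans _ _ (\sum_(i < n) mu Y)%E); last by apply: lee_sum => i _.
    elim: n => [|n IHn]; first by rewrite big_ord0 mul0e.
    by rewrite big_ord_recr/= -natr1 EFinD ge0_muleDl ?mul1e ?leeD2r// lee_fin.
  rewrite -ge0_sume_distrr; last by move=> i _; exact: leb_outer_ge0.
  by rewrite EFinM lee_wpmul2l// lee_fin.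
have := Y2n 1%N; rewrite mul1e; move: (leb_outer_ge0 Y) Y2n.
case: (mu Y) => [y| |//]; last by rewrite leye_eq.
rewrite lee_fin => y0 Y2n _; apply/eqP; rewrite eqe eq_le y0 andbT leNgt.
apply/negP => yp; have := Y2n (Num.truncn (2 ^+ d * b / y)).+1.
rewrite -EFinM lee_fin -ler_pdivlMr// leNgt.
have b0 : 0 <= b.
  by apply: exprn_ge0; apply: mulr_ge0 => //; apply: addr_ge0 => //; exact: ltW.
have by0 : 0 <= 2 ^+ d * b / y by rewrite divr_ge0 ?mulr_ge0.
by have /truncn_itv/andP[_ ->] := by0.
Qed.

(** Countably many bounded pieces at distance at least $1/(n+1)$ from [H] exhaust the set, and
    [leb_null_pulls] applies to each. *)
Lemma leb_null_of_slices Y (F : R -> R -> set V) :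
  (forall r t, leb_measurable (F r t)) ->
  (forall r t t' x, 0 < r -> 0 <= t -> t < r -> 0 <= t' -> t' < r ->
     F r t x -> F r t' x -> t = t') ->
  (forall r t, 0 < r -> 0 <= t -> t < r ->
     pulls H t (Y `&` [set y | r <= dist y]) `<=` F r t) ->
  mu (Y `&` [set y | 0 < dist y]) = 0%E.
Proof.
move=> mF dF YF; apply: leb_null_bounded => k.
pose Z (n : nat) := Y `&` [set y | n.+1%:R^-1 <= dist y] `&` [set y | enorm y <= k%:R].
apply: (@leb_null_sub _ _ _ (\bigcup_n Z n)).
  move=> y [[Yy /= y0] yk].
  have [n _ ny] := @near_infty_natSinv_lt R (PosNum y0).
  by exists n => //; split=> //; split=> //; apply: ltW; exact: (ny n (leqnn n)).
apply: leb_null_bigcup => n; have n0 : 0 < n.+1%:R^-1 :> R by rewrite invr_gt0.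
apply: (@leb_null_pulls _ k%:R n.+1%:R^-1 (F n.+1%:R^-1)) => //.
- by move=> y [].
- by move=> y [[]].
- by move=> t t' x *; apply: (dF n.+1%:R^-1 t t' x).
move=> t t0 tn; apply: subset_trans (YF _ _ n0 t0 tn).
by move=> _ [y [h [[Yy _] yh ->]]]; exists y, h.
Qed.

Lemma leb_null_ray_end s : 0 <= s -> mu (ray_end s `&` [set y | 0 < dist y]) = 0%E.
Proof.
move=> s0; apply: (leb_null_of_slices _
  (fun _ t => if 0 <= t then ray_end (s + t) else set0)).
- by move=> _ t; case: ifP => _; [exact: leb_measurable_ray_end|exact: leb_measurable0].
- move=> _ t t' x _ t0 _ t'0 _; rewrite t0 t'0 => xt xt'.
  by have := ray_end_disjoint _ _ _ (addr_ge0 s0 t0) (addr_ge0 s0 t'0) xt xt'; lra.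
move=> r t r0 t0 tr; rewrite t0; apply: pulls_ray_end => // y [_ /=].
exact: lt_le_trans.
Qed.

(** Pulling by [t] moves the level [r] to the level [r - t], and distinct levels are disjoint. *)
Lemma leb_null_dist_eq r : 0 < r -> mu [set y | dist y = r] = 0%E.
Proof.
move=> r0; apply: (@leb_null_sub _ _ _ ([set y | dist y = r] `&` [set y | 0 < dist y])).
  by move=> y /= ->.
have dc := dist_pt_continuous H H0.
apply: (leb_null_of_slices _ (fun _ t => [set y | dist y = r - t])).
- move=> _ t; rewrite (_ : [set y | _] =
    [set y | dist y <= r - t] `&` [set y | r - t <= dist y]).
    apply: leb_measurableI; apply: leb_measurable_closed.
      exact: continuous_closed_le.
    exact: continuous_closed_ge.
  apply/seteqP; split=> y /=; first by move=> ->.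
  by case=> y1 y2; apply/eqP; rewrite eq_le y1.
- by move=> _ t t' x _ _ _ _ _ /= -> ; lra.
move=> r' t r'0 t0 tr' _ [y [h [[yr /= ry] yh ->]]] /=.
have [||-> _ _] := pull_nearest y h t yh _ t0; [lra|lra|].
by rewrite yr.
Qed.

(** Since [s / r <= s / dist y], the point [h + (1 + s / r) *: (y - h)] lies on the prolonged
    shortest segment, so [h] is one of its nearest points. The factor is the same for all [y] within
    distance [r]. *)
Lemma ext_far y h g s r : nearest H y h -> 0 <= s -> 0 < r -> dist y <= r ->
  ext s y -> closure H g ->
  (1 + s / r) * enorm (y - h) <= enorm (h + (1 + s / r) *: (y - h) - g).
Proof.
move=> [Hh yh] s0 r0 yr [x [xy yx]] Hg; set k := 1 + s / r.
have [y0|y0] := eqVneq (dist y) 0.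
  by rewrite yh y0 mulr0 enorm_ge0.
have yp : 0 < dist y by rewrite lt0r y0 dist_pt_ge0.
have ray := ext_ray y h s x Hh yh s0 xy yx.
have xh : x = h + (1 + s / dist y) *: (y - h).
  have /(congr1 (fun v => (dist y)^-1 *: v)) := ray.
  rewrite !scalerA mulVf ?gt_eqF// scale1r => xyE.
  rewrite scalerDl scale1r addrCA addrA -[LHS](subrK y) xyE [_^-1 * _]mulrC.
  by apply/rowP => i; rewrite !mxE; ring.
have kd : k <= 1 + s / dist y.
  by rewrite lerD2l ler_wpM2l// lef_pV2 ?posrE.
have xk : enorm (x - (h + k *: (y - h))) = (1 + s / dist y - k) * dist y.
  rewrite xh (_ : _ - _ = (1 + s / dist y - k) *: (y - h)); last first.
    by apply/rowP => i; rewrite !mxE; ring.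
  by rewrite enormZ yh ger0_norm// subr_ge0.
have := ler_edist_add (h + k *: (y - h)) x g; rewrite xk yh.
have := dist_pt_le_closure H x g Hg.
have -> : (1 + s / dist y - k) * dist y = dist y + s - k * dist y.
  by field; rewrite gt_eqF.
by move: yx; lra.
Qed.

(** Each nearest point lies outside the ball that [ext_far] attaches to the other. The squared
    inequalities say $2k\,q\cdot w_1\ge-|q|^2$ and $2k\,q\cdot w_2\le|q|^2$ for $q=h_1-h_2$; with
    Cauchy-Schwarz they give the constant $k/(k-1)=1+r/s$. *)
Lemma nearest_lipschitz y1 y2 h1 h2 s r : nearest H y1 h1 -> nearest H y2 h2 ->
  0 < s -> 0 < r -> dist y1 <= r -> dist y2 <= r -> ext s y1 -> ext s y2 ->
  enorm (h1 - h2) <= (1 + r / s) * enorm (y1 - y2).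
Proof.
move=> n1 n2 s0 r0 r1 r2 e1 e2.
have := ext_far y1 h1 h2 s r n1 (ltW s0) r0 r1 e1 n2.1.
have := ext_far y2 h2 h1 s r n2 (ltW s0) r0 r2 e2 n1.1.
set k := 1 + s / r; have k1 : 0 < k - 1 by rewrite addrC addKr divr_gt0.
have k0 : 0 <= k by lra.
rewrite !enorm_ge ?mulr_ge0 ?enorm_ge0// !exprMn !sqr_enorm.
set w1 := y1 - h1; set w2 := y2 - h2.
have -> : h1 + k *: w1 - h2 = (h1 - h2) + k *: w1 by rewrite addrAC.
have -> : h2 + k *: w2 - h1 = k *: w2 - (h1 - h2) by rewrite opprB addrAC addrC addrA.
have yE : y1 - y2 = w1 - w2 + (h1 - h2).
  by rewrite /w1 /w2; apply/rowP => i; rewrite !mxE; ring.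
rewrite yE {yE}; clearbody w1 w2; move: (h1 - h2) => q.
have [q0|q0] := eqVneq (enorm q) 0.
  by rewrite q0 mulr_ge0 ?enorm_ge0 ?addr_ge0 ?divr_ge0 ?(ltW s0) ?(ltW r0).
have qp : 0 < enorm q by rewrite lt0r q0 enorm_ge0.
have := cauchy_schwarz (w1 - w2 + q) q; rewrite !dotE -(sqr_enorm q).
move: (enorm (w1 - w2 + q)) => c cs.
rewrite (dotC q w1) (dotC q w2) => H2 H1.
have main : (k - 1) * enorm q ^+ 2 <= k * c * enorm q.
  by have := ler_wpM2l k0 cs; lra.
have main' : (k - 1) * enorm q <= k * c by move: main; rewrite expr2 mulrA ler_pM2r.
have -> : 1 + r / s = k / (k - 1).
  by rewrite /k; field; rewrite !gt_eqF//; lra.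
by rewrite mulrAC ler_pdivlMr// mulrC.
Qed.

End RayExtension.

(** * The approach map *)

Section ApproachMap.
Context {R : realType} {d : nat}.
Local Notation V := 'rV[R]_d.+1.
Local Notation mu := (@leb_outer R d.+1).
Variables (H : set V) (pi : V -> V).
Hypotheses (H0 : H !=set0) (Hpi : nearest_point_map H pi).
Implicit Types (A : set V) (x y h : V) (s r D : R).
Local Notation dist x := (dist_pt x H).

Lemma approach_pull D x : 0 < dist x -> D <= dist x ->
  approach H pi D x = pull (pi x) D x.
Proof.
move=> x0; rewrite /approach /pull le_eqVlt => /predU1P[->|->//].
rewrite ltxx -(enorm_sym x) (Hpi x).2 divff ?gt_eqF// scale1r.
by rewrite addrC subrK.
Qed.

(** The Lipschitz estimate with both base points equal to [y]. *)
Lemma nearest_unique s y h : 0 < s -> ext H s y -> nearest H y h -> h = pi y.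
Proof.
move=> s0 ys yh; have r0 : 0 < dist y + 1 by rewrite ltr_wpDl// dist_pt_ge0.
have yr : dist y <= dist y + 1 by rewrite lerDl.
have := nearest_lipschitz H H0 y y h (pi y) s _ yh (Hpi y) s0 r0 yr yr ys ys.
rewrite subrr enorm0 mulr0 => hpi; apply/eqP; rewrite -subr_eq0; apply/eqP.
by apply/enorm_eq0/eqP; rewrite eq_le hpi enorm_ge0.
Qed.

Lemma approach_pulls D A : (forall x, A x -> 0 < dist x) ->
  (forall x, A x -> D <= dist x) -> approach H pi D @` A `<=` pulls H D A.
Proof.
move=> A0 AD _ [x Ax <-]; exists x, (pi x); split=> //.
by apply: approach_pull; [exact: A0|exact: AD].
Qed.

Lemma lipschitz_approach D r s rho : 0 <= D -> 0 < r -> D <= r -> 0 < s -> 0 < rho ->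
  lipschitz_on (ext H s `&` [set x | r <= dist x <= rho])
    (1 + D * (2 / r) * (2 + rho / s)) (approach H pi D).
Proof.
move=> D0 r0 Dr s0 rho0 x y [xs /andP[rx xrho]] [ys /andP[ry yrho]].
have x0 : 0 < dist x by exact: lt_le_trans rx.
have y0 : 0 < dist y by exact: lt_le_trans ry.
rewrite !approach_pull//; [|exact: le_trans ry|exact: le_trans rx].
have px := Hpi x; have py := Hpi y.
have := pull_lipschitz x y (pi x) (pi y) D r D0 r0.
rewrite px.2 py.2 => /(_ rx y0) /le_trans; apply.
rewrite [leRHS]mulrDl mul1r lerD2l -[leRHS]mulrA; apply: ler_wpM2l.
  by rewrite mulr_ge0// divr_ge0// ltW.
have -> : pi x - x - (pi y - y) = (pi x - pi y) + (y - x).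
  by apply/rowP => i; rewrite !mxE; ring.
apply: le_trans (ler_enormD _ _) _; rewrite (enorm_sym y).
have := nearest_lipschitz H H0 x y _ _ s rho px py s0 rho0 xrho yrho xs ys.
by lra.
Qed.

(** The image consists of points with maximal prolongation exactly [D], off [H], and these form a
    null set. *)
Lemma leb_null_approach_ray_end A D r : 0 <= D -> D < r ->
  (forall x, A x -> r <= dist x) ->
  mu (approach H pi D @` (A `&` ray_end H 0)) = 0%E.
Proof.
move=> D0 Dr Ar; apply: (leb_null_sub _ _ _ (leb_null_ray_end H H0 D D0)).
move=> z zA.
have : pulls H D (A `&` ray_end H 0) z.
  apply: approach_pulls zA => x [/Ar xr _]; [|exact: le_trans (ltW Dr) xr].
  exact: lt_le_trans (le_lt_trans D0 Dr) xr.
move=> zp; split; last first.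
  case: zp => [x [h [[/Ar xr _] xh ->]]] /=.
  have [||-> _ _] := pull_nearest H H0 x h D xh _ D0; [lra|lra|lra].
rewrite -[D]add0r; apply: (pulls_ray_end H H0 (A `&` ray_end H 0)) => //.
by move=> x [/Ar xr _]; exact: lt_le_trans xr.
Qed.

Lemma leb_measurable_approach A D r : 0 <= D -> D < r -> leb_measurable A ->
  (forall x, A x -> r <= dist x) -> leb_measurable (approach H pi D @` A).
Proof.
move=> D0 Dr mA Ar; have r0 : 0 < r by exact: le_lt_trans Dr.
(* Prolongation by at least $1/(n+1)$ and boundedness, which also bounds the distance to [H], make
   the approach map Lipschitz on each piece. The pieces miss only [ray_end H 0]. *)
pose X n (k : nat) := A `&` ext H n.+1%:R^-1 `&` [set x | enorm x <= k%:R].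
have -> : approach H pi D @` A = (\bigcup_n \bigcup_k (approach H pi D @` X n k))
    `|` approach H pi D @` (A `&` ray_end H 0).
  under eq_bigcupr do rewrite -image_bigcup.
  rewrite -image_bigcup -image_setU; congr (_ @` _); apply/seteqP; split=> x.
    move=> Ax; have [[n _ xn]|nx] := pselect ((\bigcup_n ext H (0 + n.+1%:R^-1)) x).
      left; exists n => //; exists (Num.truncn (enorm x)).+1 => //.
      split; first by split=> //; rewrite add0r in xn.
      by have /truncn_itv/andP[_ /ltW] := enorm_ge0 x.
    right; split=> //; split=> //; exists x.
    by rewrite subrr enorm0 addr0.
  by case=> [[n _ [k _ [[]]]]|[]].
apply: leb_measurableU; last exact/leb_null_measurable/(leb_null_approach_ray_end _ _ r).
apply: leb_measurable_bigcup => n; apply: leb_measurable_bigcup => k.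
have n0 : 0 < n.+1%:R^-1 :> R by rewrite invr_gt0.
pose rho := dist 0 + k%:R + 1.
have d00 := dist_pt_ge0 H H0 0.
have rho0 : 0 < rho by rewrite ltr_wpDl// addr_ge0.
apply: (leb_measurable_lipschitz_image _ k%:R
  (1 + D * (2 / r) * (2 + rho / n.+1%:R^-1))) => //.
- apply: leb_measurableI.
    by apply: leb_measurableI => //; exact: leb_measurable_ext.
  by apply: leb_measurable_closed; apply: continuous_closed_le; exact: enorm_continuous.
- by move=> x [].
- have q1 : 0 <= 2 / r by rewrite divr_ge0// ltW.
  have q2 : 0 <= rho / n.+1%:R^-1 by rewrite divr_ge0// ltW.
  by apply: addr_ge0 => //; apply: mulr_ge0; [exact: mulr_ge0|exact: addr_ge0].
have Xsub x : X n k x -> (ext H n.+1%:R^-1 `&` [set x | r <= dist x <= rho]) x.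
  move=> [[/Ar xr xn] /= xk]; split=> //=; rewrite xr /rho.
  by have := dist_pt_lipschitz H H0 x 0; rewrite subr0; lra.
move=> x y Xx Xy.
exact: (lipschitz_approach _ _ _ _ D0 r0 (ltW Dr) n0 rho0 _ _ (Xsub _ Xx) (Xsub _ Xy)).
Qed.

(** Outside the null set of ray ends the nearest point is unique, so the multivalued image is
    contained in the image under [approach]. *)
Lemma leb_outer_approach A D r : 0 <= D -> D < r ->
  (forall x, A x -> r <= dist x) ->
  (mu A <= ((1 + D / (r - D)) ^+ d)%:E * mu (approach H pi D @` A))%E.
Proof.
move=> D0 Dr Ar; pose A' := A `\` ray_end H 0.
have r0 : 0 < r by exact: le_lt_trans Dr.
have rD0 : 0 < r - D by rewrite subr_gt0.
apply: (@le_trans _ _ (mu A')).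
  rewrite -(leb_outerU_null A' (A `&` ray_end H 0)).
    apply: le_leb_outer => x Ax.
    by have [?|?] := pselect (ray_end H 0 x); [right|left].
  apply: (leb_null_sub _ _ _ (leb_null_ray_end H H0 0 (lexx 0))) => x [/Ar xr x0].
  by split=> //; exact: lt_le_trans xr.
apply: le_trans (leb_outer_pulls H H0 A' D r D0 Dr _) _; first by move=> x [/Ar].
apply: lee_wpmul2l; first by rewrite lee_fin exprn_ge0// addr_ge0// divr_ge0// ltW.
apply: le_leb_outer => _ [x [h [[Ax xend] xh ->]]]; exists x => //.
have xr := Ar _ Ax.
rewrite approach_pull ?(lt_le_trans r0 xr) ?(le_trans (ltW Dr) xr)//.
have [n xn] : exists n : nat, ext H n.+1%:R^-1 x.
  apply: contrapT => nx; apply: xend; split.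
    by exists x; rewrite subrr enorm0 addr0.
  by move=> [n _]; rewrite add0r => xn; apply: nx; exists n.
by rewrite (nearest_unique n.+1%:R^-1 x h)// invr_gt0.
Qed.

(* Such nearest points are also nearest points of the midpoints, which lie on a
   null level set of the distance, where [pi] is Lipschitz. *)
Lemma leb_null_nearest_of_level r : 0 < r ->
  mu (pi @` [set x | dist x = r]) = 0%E.
Proof.
move=> r0; have r20 : 0 < r / 2 by rewrite divr_gt0.
pose W := ext H (r / 2) `&` [set z | dist z = r / 2].
have W0 : mu W = 0%E.
  by apply: (leb_null_sub _ _ _ (leb_null_dist_eq H H0 _ r20)) => x [].
apply: (leb_null_sub _ (pi @` W)).
  move=> _ [x /= xr <-].
  have x0 : 0 < dist x by rewrite xr.
  have x2 : r / 2 <= dist x by rewrite xr; lra.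
  have [zd zh _] := pull_nearest H H0 x (pi x) (r / 2) (Hpi x) x0 (ltW r20) x2.
  (* The segment to the midpoint prolongs by [r / 2], back to [x]. *)
  have ze : ext H (r / 2) (pull (pi x) (r / 2) x).
    have : ext H (0 + r / 2) (pull (pi x) (r / 2) x); last by rewrite add0r.
    apply: (pull_ext H H0 x) => //; first exact: ltW.
    by exists x; rewrite subrr enorm0 addr0.
  exists (pull (pi x) (r / 2) x); first by split=> //=; rewrite zd xr; lra.
  apply/esym/(nearest_unique (r / 2)) => //; split; first exact: (Hpi x).1.
  by rewrite zh zd.
apply: (leb_null_lipschitz W (1 + (r / 2) / (r / 2))) => //.
  by apply: addr_ge0 => //; rewrite divr_ge0// ltW.
move=> x y [xe /= xr] [ye /= yr].
by apply: (nearest_lipschitz H H0 x y _ _ _ _ (Hpi x) (Hpi y)) => //; rewrite ?xr ?yr.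
Qed.

Lemma approach_level_null A r : 0 < r ->
  mu (approach H pi r @` (A `&` [set x | dist x = r])) = 0%E.
Proof.
move=> r0; apply: (leb_null_sub _ _ _ (leb_null_nearest_of_level r r0)).
by move=> _ [x [Ax /= xr] <-]; exists x => //; rewrite /approach xr ltxx.
Qed.

(** Exhausts the points farther than [r] with a positive gap, where the estimates for [D < r] apply
    with [D = r]. *)
Definition beyond A r (n : nat) := A `&` [set x | r + n.+1%:R^-1 <= dist x].

Lemma beyond_cover A r : (forall x, A x -> r <= dist x) ->
  A = \bigcup_n beyond A r n `|` (A `&` [set x | dist x = r]).
Proof.
move=> Ar; apply/seteqP; split=> x; last by case=> [[n _]|] [].
move=> Ax; have := Ar _ Ax; rewrite le_eqVlt => /predU1P[xr|xr].
  by right; split=> //=; rewrite -xr.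
left; have xr0 : 0 < dist x - r by rewrite subr_gt0.
have [n _ ne] := @near_infty_natSinv_lt R (PosNum xr0).
exists n => //; split=> //=; rewrite -lerBrDl; apply: ltW.
exact: (ne n (leqnn n)).
Qed.

Lemma leb_measurable_approach_level A r : 0 < r -> leb_measurable A ->
  (forall x, A x -> r <= dist x) -> leb_measurable (approach H pi r @` A).
Proof.
move=> r0 mA Ar; rewrite (beyond_cover A r Ar) image_setU image_bigcup.
apply: leb_measurableU; last exact/leb_null_measurable/approach_level_null.
apply: leb_measurable_bigcup => n.
apply: (leb_measurable_approach _ _ (r + n.+1%:R^-1)); [exact: ltW| | |].
- by rewrite ltrDl invr_gt0.
- apply: leb_measurableI => //; apply: leb_measurable_closed.
  by apply: continuous_closed_ge; exact: dist_pt_continuous.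
by move=> x [].
Qed.

(** The ambient dimension is 1: the factor has exponent 0 and stays 1 as the gap $1/(n+1)$
    shrinks. *)
Lemma leb_outer_approach_level A r : 0 < r -> d = 0%N ->
  (forall x, A x -> r <= dist x) -> (mu A <= mu (approach H pi r @` A))%E.
Proof.
move=> r0 d0 Ar; rewrite {1}(beyond_cover A r Ar) leb_outerU_null; last first.
  by apply: (leb_null_sub _ _ _ (leb_null_dist_eq H H0 _ r0)) => x [].
apply: leb_outer_nondecreasing => [k m km x [Ax xk]|n].
  split=> //=; apply: le_trans xk; rewrite lerD2l lef_pV2 ?posrE//.
  by rewrite ler_nat ltnS.
apply: (@le_trans _ _ (mu (approach H pi r @` beyond A r n))).
  have rn : r < r + n.+1%:R^-1 by rewrite ltrDl invr_gt0.
  apply: le_trans (leb_outer_approach (beyond A r n) r _ (ltW r0) rn _) _.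
    by move=> x [].
  by rewrite [X in _ ^+ X]d0 expr0 mul1e.
by apply: le_leb_outer; apply: image_subset => x [].
Qed.

End ApproachMap.

Theorem theorem2 (R : realType) (d : nat) (H A : set 'rV[R]_d)
  (pi : 'rV[R]_d -> 'rV[R]_d) (Rr Delta : R) :
  (0 < d)%N ->
  H !=set0 ->
  nearest_point_map H pi ->
  leb_measurable A ->
  (Rr%:E <= dist_set H A)%E ->
  Delta <= Rr -> 0 <= Delta -> 0 < Rr ->
  leb_measurable (approach H pi Delta @` A) /\
  ((((Rr - Delta) / Rr) ^+ d.-1)%:E * Leb A <= Leb (approach H pi Delta @` A))%E.
Proof.
case: d => // d in H A pi *; move=> _ H0 Hpi mA RHA DR D0 R0.
have AR x : A x -> Rr <= dist_pt x H.
  move=> Ax; rewrite -lee_fin; apply: le_trans RHA _.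
  by apply: ereal_inf_lbound; exists x.
(* The general bound divides by [Rr - Delta], so equality is treated apart: the constant is then 0
   unless the dimension is 1, where it is [0 ^+ 0 = 1]. *)
rewrite /Leb /=; have [DltR|] := ltP Delta Rr; last first.
  move=> RD; have -> : Delta = Rr by apply/eqP; rewrite eq_le DR.
  split; first exact: leb_measurable_approach_level.
  rewrite subrr mul0r; have [d0|d0] := posnP d.
    by rewrite [X in _ ^+ X]d0 expr0 mul1e leb_outer_approach_level.
  by rewrite expr0n gtn_eqF// mul0e leb_outer_ge0.
split; first exact: (leb_measurable_approach H pi H0 Hpi A Delta Rr).
have c0 : 0 <= (Rr - Delta) / Rr by rewrite divr_ge0 ?subr_ge0// ltW.
have RD0 : 0 < Rr - Delta by rewrite subr_gt0.
have bound := leb_outer_approach H pi H0 Hpi A Delta Rr D0 DltR AR.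
apply: le_trans (lee_wpmul2l _ bound) _.
  by rewrite lee_fin exprn_ge0.
(* The two bases are inverse to each other, as $1+\Delta/(R-\Delta)=R/(R-\Delta)$. *)
rewrite muleA -EFinM -exprMn (_ : _ / _ * _ = 1) ?expr1n ?mul1e//.
by field; rewrite !gt_eqF.
Qed.
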